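(* Let $x \in \mathbb{C}\setminus(\mathbb{R}^-\cup\{1\})$ and let $\nu\in\mathbb{C}$ with $\mathrm{Re}(\nu)<0$. The linear operator $\mathfrak{L}$ on $\mathscr{H}_0$ (defined in the context) can be factorized as $$\mathfrak{L}=\frac{x\,\nu(1-\nu)}{1-x}\cdot\delta\circ\mathfrak{M},$$ where $\delta=z\,\frac{\mathrm{d}}{\mathrm{d}z}$ and $\mathfrak{M}$ is the integral operator defined for all $f\in\mathscr{H}_0$ by $$\mathfrak{M}f(z)=\int_0^1 e^{-\frac{z}{x}t^{-\nu}(1-(1-x)t)}\,f\left(\frac{z}{x}\,t^{-\nu}(1-t)\right)\frac{\mathrm{d}t}{t},\qquad z\in\mathbb{C}.$$
   Context: $\mathbb{R}^-=\,]-\infty,0]$. $\mathscr{H}_0$ is the linear space of entire functions on $\mathbb{C}$ vanishing at $0$. With $\mathfrak{R}(\zeta) = (1-\zeta)^{-\nu}(1-(1-x)\zeta)^{\nu-1}$ for $\zeta\in[0,1]$ (principal branches) and $c=\frac{1-\nu x}{1-x}$, the operator $\mathfrak{L}:\mathscr{H}_0\to\mathscr{H}_0$ is $$\mathfrak{L}f(z)=\int_0^1\Big[(1+z\,\mathfrak{R}(\zeta))\,f(\zeta\,\mathfrak{R}(\zeta)\,z)-c\,z\,\mathfrak{R}(\zeta)\,f'(\zeta\,\mathfrak{R}(\zeta)\,z)\Big]e^{-\mathfrak{R}(\zeta)z}\,\mathrm{d}\zeta,\qquad z\in\mathbb{C},\ f\in\mathscr{H}_0.$$ *)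

(* Defs.v *)
From Stdlib Require Export Reals.
From Coquelicot Require Export Coquelicot.

Open Scope C_scope.

(** * Complex exponential and principal branches *)

Definition Cexp (w : C) : C :=
  (exp (Re w) * cos (Im w), exp (Re w) * sin (Im w))%R.

(** Principal argument, with values in ]-PI, PI]. *)
Definition Carg (w : C) : R :=
  if Rle_dec 0 (Im w)
  then acos (Re w / Cmod w)
  else (- acos (Re w / Cmod w))%R.

Definition Clog (w : C) : C := (ln (Cmod w), Carg w).

(** At the base [0], where [Clog] is a junk value, we take [0 ^ a = 0]. This is
    the limit of [w ^ a] along positive [w -> 0] when [0 < Re a]; it matters
    only for the values of the integrands below at an end point. *)
Definition Cpower (w a : C) : C :=
  if Ceq_dec w 0 then 0 else Cexp (a * Clog w).

(** The closed negative real axis ]-oo, 0], as a subset of [C]. *)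
Definition nonpos_real (w : C) : Prop := (Im w = 0 /\ Re w <= 0)%R.

(** * Entire functions vanishing at [0] *)

(** Taking [C_AbsRing] as the scalars makes this complex differentiability. *)
Definition entire (f : C -> C) : Prop :=
  forall z : C, ex_derive (K := C_AbsRing) (V := C_NormedModule) f z.

Definition scrH0 (f : C -> C) : Prop := entire f /\ f 0 = 0.

(** * The operators *)

(** For an entire [f], [C_derive f] is the complex derivative
    ([C_derive_correct]). *)
Definition delta (f : C -> C) (z : C) : C := z * C_derive f z.

Definition frakR (x nu : C) (zeta : R) : C :=
  Cpower (1 - zeta) (- nu) * Cpower (1 - (1 - x) * zeta) (nu - 1).

Definition frakL_integrand (x nu : C) (f : C -> C) (z : C) (zeta : R) : C :=
  let r := frakR x nu zeta in
  let c := (1 - nu * x) / (1 - x) in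
  ((1 + z * r) * f (zeta * r * z) - c * z * r * C_derive f (zeta * r * z))
    * Cexp (- r * z).

Definition frakL (x nu : C) (f : C -> C) (z : C) : C :=
  RInt (V := C_R_CompleteNormedModule) (frakL_integrand x nu f z) 0%R 1%R.

Definition frakM_integrand (x nu : C) (f : C -> C) (z : C) (t : R) : C :=
  Cexp (- (z / x * Cpower t (- nu) * (1 - (1 - x) * t)))
    * f (z / x * Cpower t (- nu) * (1 - t)) / t.

(** The integrand may be unbounded at [0] (it is of order
    [t ^ (- Re nu - 1)]), hence an improper integral at that end point. *)
Definition frakM (x nu : C) (f : C -> C) (z : C) : C :=
  RInt_gen (V := C_R_CompleteNormedModule)
    (frakM_integrand x nu f z) (at_right 0%R) (at_point 1%R).

(* Main.v *)
(** In the variable [u = ln t] the integrand of [frakM] is the restriction to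
    ]-oo, 0] of an entire function [kernel x nu f z], which decays like
    [exp (- Re nu * Re u)] as [Re u -> -oo] with [Im u] bounded. The arc
    [u = ln (1 - zeta) - log (1 - (1 - x) zeta)], [0 <= zeta < 1], also joins [0]
    to [-oo] in the strip [|Im u| < PI], and along it the exponent and the
    dilation factor in the kernel become [z R] and [zeta R]. By Cauchy's theorem
    the integral defining [delta (frakM f)] may be moved to this arc, and there
    it differs from the integral defining [frakL f] by the integral of the exact
    derivative of [(zeta - c) exp (- z R) f (z zeta R)], which vanishes at both
    ends. *)

Require Import Defs.
From Stdlib Require Import Reals Lra Psatz ClassicalEpsilon.
From Coquelicot Require Import Coquelicot.

Open Scope R_scope.
Open Scope C_scope.

(** * Derivatives of complex-valued functions *)

(** The constants [c] and [K0 = x nu (1 - nu) / (1 - x)] come from one identity along the arc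
    [u (zeta)]: [((zeta - c) R)' = K0 R u'], where [u' = - x / ((1 - zeta) (1 - (1 - x) zeta))]. It
    removes [R'] from the derivative of the boundary term: what carries [u'] is [K0 z u'] times the
    derivative of the kernel in [z], and the rest is the integrand of [frakL]. The arc goes to
    infinity at height [- arg x], not along the real axis. Decay is therefore estimated on the whole
    half-strip; it comes from [Re nu < 0] and, for the kernel itself, from [f 0 = 0]. No contour has
    to be closed at infinity: a single global primitive of the entire integrand is evaluated on the
    arc and on the real half-line, and both ends see the same limit. Such primitives, and the fact
    that a derivative is again entire, must be had from mere complex differentiability. Continuity
    of the derivative is the obstacle; Goursat's theorem and a Cauchy formula for the derivative
    remove it. *)

(** Differentiation along an inclusion [i] of the domain into [C]: taking
    [i := fun z => z] gives complex differentiability and [i := RtoC] the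
    derivative of a path, so that one set of rules serves both. *)
Definition is_der {K : Type} (i : K -> C) (f : K -> C) (z : K) (l : C) : Prop :=
  forall eps : R, (0 < eps)%R -> exists d : R, (0 < d)%R /\
    forall w : K, (Cmod (i w - i z) < d)%R ->
      (Cmod (f w - f z - (i w - i z) * l) <= eps * Cmod (i w - i z))%R.

Definition cont {K : Type} (i : K -> C) (f : K -> C) (z : K) : Prop :=
  forall eps : R, (0 < eps)%R -> exists d : R, (0 < d)%R /\
    forall w : K, (Cmod (i w - i z) < d)%R -> (Cmod (f w - f z) < eps)%R.

Notation holo := (is_der (fun z : C => z)).
Notation path_der := (is_der RtoC).

Lemma Cmod_sub_sym (a b : C) : Cmod (a - b) = Cmod (b - a).
Proof. rewrite <- Cmod_opp; f_equal; ring. Qed.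

Lemma Cmod_triangle_sub (a b : C) : (Cmod (a - b) <= Cmod a + Cmod b)%R.
Proof. unfold Cminus; rewrite <- (Cmod_opp b); apply Cmod_triangle. Qed.

Lemma Cmod_le_plus_sub (a b : C) : (Cmod a <= Cmod b + Cmod (a - b))%R.
Proof. replace a with (b + (a - b)) at 1 by ring; apply Cmod_triangle. Qed.

Lemma Im_le_Cmod (z : C) : (Rabs (Im z) <= Cmod z)%R.
Proof.
  generalize (Rmax_Cmod z) (Rmax_r (Rabs (fst z)) (Rabs (snd z))).
  unfold Im; lra.
Qed.

Lemma is_der_ext {K} (i f g : K -> C) z l :
  (forall w, f w = g w) -> is_der i f z l -> is_der i g z l.
Proof.
  intros E H eps He; destruct (H eps He) as [d [Hd D]]; exists d; split; auto.
  intros w Hw; rewrite <- !E; auto.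
Qed.

Lemma is_der_eq {K} (i f : K -> C) z l l' :
  is_der i f z l -> l = l' -> is_der i f z l'.
Proof. intros H <-; exact H. Qed.

Lemma is_der_cont {K} (i f : K -> C) z l : is_der i f z l -> cont i f z.
Proof.
  intros H eps He; destruct (H 1%R Rlt_0_1) as [d [Hd D]].
  assert (Hl := Cmod_ge_0 l).
  exists (Rmin d (eps / (2 + Cmod l)))%R; split.
  { apply Rmin_pos; auto; apply Rdiv_lt_0_compat; lra. }
  intros w Hw.
  assert (H1 := Rlt_le_trans _ _ _ Hw (Rmin_l _ _)).
  assert (H2 := Rlt_le_trans _ _ _ Hw (Rmin_r _ _)).
  generalize (D w H1) (Cmod_le_plus_sub (f w - f z) ((i w - i z) * l)).
  rewrite Cmod_mult; intros H3 H4.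
  apply Rle_lt_trans with (Cmod (i w - i z) * (2 + Cmod l))%R.
  { generalize (Cmod_ge_0 (i w - i z)); nra. }
  apply Rlt_div_r; lra.
Qed.

Lemma is_der_const {K} (i : K -> C) c z : is_der i (fun _ => c) z 0.
Proof.
  intros eps He; exists 1%R; split; [lra|]; intros w _.
  replace (c - c - (i w - i z) * 0) with (RtoC 0) by ring.
  rewrite Cmod_0; generalize (Cmod_ge_0 (i w - i z)); nra.
Qed.

Lemma is_der_incl {K} (i : K -> C) z : is_der i i z 1.
Proof.
  intros eps He; exists 1%R; split; [lra|]; intros w _.
  replace (i w - i z - (i w - i z) * 1) with (RtoC 0) by ring.
  rewrite Cmod_0; generalize (Cmod_ge_0 (i w - i z)); nra.
Qed.

Lemma is_der_plus {K} (i f g : K -> C) z l m :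
  is_der i f z l -> is_der i g z m -> is_der i (fun w => f w + g w) z (l + m).
Proof.
  intros Hf Hg eps He.
  destruct (Hf (eps / 2)%R) as [d [Hd D]]; [lra|].
  destruct (Hg (eps / 2)%R) as [d' [Hd' D']]; [lra|].
  exists (Rmin d d'); split; [apply Rmin_pos; auto|]; intros w Hw.
  generalize (D w (Rlt_le_trans _ _ _ Hw (Rmin_l _ _)))
    (D' w (Rlt_le_trans _ _ _ Hw (Rmin_r _ _))).
  replace (f w + g w - (f z + g z) - (i w - i z) * (l + m)) with
    ((f w - f z - (i w - i z) * l) + (g w - g z - (i w - i z) * m)) by ring.
  generalize (Cmod_triangle (f w - f z - (i w - i z) * l)
    (g w - g z - (i w - i z) * m)); lra.
Qed.

Lemma is_der_comp {K} (i g : K -> C) (f : C -> C) z l m :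
  holo f (g z) l -> is_der i g z m -> is_der i (fun w => f (g w)) z (l * m).
Proof.
  intros Hf Hg eps He.
  assert (Hl := Cmod_ge_0 l); assert (Hm := Cmod_ge_0 m).
  (* The error splits into that of [f], of size [e1 * Cmod k], and that of [g] multiplied by [l];
     each gets half of [eps]. The bound [e2 <= 1] makes the increment [k] of [g] at most
     [Cmod m + 1] times that of the variable. *)
  set (e1 := (eps / (2 * (Cmod m + 1)))%R).
  set (e2 := Rmin 1 (eps / (2 * (Cmod l + 1)))%R).
  assert (He1 : (0 < e1)%R) by (apply Rdiv_lt_0_compat; lra).
  assert (He2 : (0 < e2)%R)
    by (apply Rmin_pos; [lra | apply Rdiv_lt_0_compat; lra]).
  destruct (Hf e1 He1) as [d [Hd D]].
  destruct (is_der_cont _ _ _ _ Hg d Hd) as [d1 [Hd1 D1]].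
  destruct (Hg e2 He2) as [d2 [Hd2 D2]].
  exists (Rmin d1 d2); split; [apply Rmin_pos; auto|]; intros w Hw.
  generalize (D _ (D1 w (Rlt_le_trans _ _ _ Hw (Rmin_l _ _))))
    (D2 w (Rlt_le_trans _ _ _ Hw (Rmin_r _ _))).
  set (t := i w - i z); set (k := g w - g z); intros Ha Hb.
  assert (Hk : (Cmod k <= (Cmod m + 1) * Cmod t)%R).
  { generalize (Cmod_le_plus_sub k (t * m)) (Rmin_l 1 (eps / (2 * (Cmod l + 1)))).
    fold e2; rewrite Cmod_mult; generalize (Cmod_ge_0 t); nra. }
  replace (f (g w) - f (g z) - t * (l * m)) with
    ((f (g w) - f (g z) - k * l) + (k - t * m) * l) by ring.
  eapply Rle_trans; [apply Cmod_triangle|]; rewrite Cmod_mult.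
  assert (Hc : (e1 * Cmod k <= eps / 2 * Cmod t)%R).
  { apply Rle_trans with (e1 * ((Cmod m + 1) * Cmod t))%R.
    - apply Rmult_le_compat_l; lra.
    - right; unfold e1; field; lra. }
  assert (Hf2 : (e2 * (Cmod l + 1) <= eps / 2)%R).
  { apply Rle_trans with (eps / (2 * (Cmod l + 1)) * (Cmod l + 1))%R.
    - apply Rmult_le_compat_r; [lra | apply Rmin_r].
    - right; field; lra. }
  generalize (Cmod_ge_0 t); nra.
Qed.

Lemma holo_scal (c z : C) : holo (fun w => c * w) z c.
Proof.
  intros eps He; exists 1%R; split; [lra|]; intros w _.
  replace (c * w - c * z - (w - z) * c) with (RtoC 0) by ring.
  rewrite Cmod_0; generalize (Cmod_ge_0 (w - z)); nra.
Qed.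

Lemma is_der_scal {K} (i f : K -> C) c z l :
  is_der i f z l -> is_der i (fun w => c * f w) z (c * l).
Proof. intros H; exact (is_der_comp i f _ z _ _ (holo_scal c (f z)) H). Qed.

Lemma is_der_opp {K} (i f : K -> C) z l :
  is_der i f z l -> is_der i (fun w => - f w) z (- l).
Proof.
  intros H; apply is_der_eq with (- (1) * l); [|ring].
  apply is_der_ext with (fun w => - (1) * f w); [intros; ring|].
  now apply is_der_scal.
Qed.

Lemma is_der_minus {K} (i f g : K -> C) z l m :
  is_der i f z l -> is_der i g z m -> is_der i (fun w => f w - g w) z (l - m).
Proof. intros Hf Hg; apply is_der_plus; auto; now apply is_der_opp. Qed.

Lemma holo_sqr (z : C) : holo (fun w => w * w) z (2 * z).
Proof.
  intros eps He; exists eps; split; [lra|]; intros w Hw.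
  replace (w * w - z * z - (w - z) * (2 * z)) with ((w - z) * (w - z)) by ring.
  rewrite Cmod_mult; generalize (Cmod_ge_0 (w - z)); nra.
Qed.

(** By polarization: [4 f g = (f + g)^2 - (f - g)^2]. *)
Lemma is_der_mult {K} (i f g : K -> C) z l m :
  is_der i f z l -> is_der i g z m ->
  is_der i (fun w => f w * g w) z (l * g z + f z * m).
Proof.
  intros Hf Hg.
  apply is_der_eq with
    (/ 4 * (2 * (f z + g z) * (l + m) - 2 * (f z - g z) * (l - m)));
    [|field; intro E; injection E; lra].
  apply is_der_ext with
    (fun w => / 4 * ((f w + g w) * (f w + g w) - (f w - g w) * (f w - g w)));
    [intros; field; intro E; injection E; lra|].
  apply is_der_scal, is_der_minus.
  - apply (is_der_comp i (fun w => f w + g w) (fun w => w * w));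
      [apply holo_sqr | now apply is_der_plus].
  - apply (is_der_comp i (fun w => f w - g w) (fun w => w * w));
      [apply holo_sqr | now apply is_der_minus].
Qed.

(** * Rules for continuity *)

Lemma cont_ext {K} (i f g : K -> C) z :
  (forall w, f w = g w) -> cont i f z -> cont i g z.
Proof.
  intros E H eps He; destruct (H eps He) as [d [Hd D]]; exists d; split; auto.
  intros w Hw; rewrite <- !E; auto.
Qed.

Lemma cont_comp {K} (i g : K -> C) (f : C -> C) z :
  cont (fun w => w) f (g z) -> cont i g z -> cont i (fun w => f (g w)) z.
Proof.
  intros Hf Hg eps He; destruct (Hf eps He) as [d [Hd D]].
  destruct (Hg d Hd) as [d' [Hd' D']]; exists d'; auto.
Qed.

Lemma cont_const {K} (i : K -> C) c z : cont i (fun _ => c) z.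
Proof. exact (is_der_cont _ _ _ _ (is_der_const i c z)). Qed.

Lemma cont_incl {K} (i : K -> C) z : cont i i z.
Proof. exact (is_der_cont _ _ _ _ (is_der_incl i z)). Qed.

Lemma cont_plus {K} (i f g : K -> C) z :
  cont i f z -> cont i g z -> cont i (fun w => f w + g w) z.
Proof.
  intros Hf Hg eps He.
  destruct (Hf (eps / 2)%R) as [d [Hd D]]; [lra|].
  destruct (Hg (eps / 2)%R) as [d' [Hd' D']]; [lra|].
  exists (Rmin d d'); split; [apply Rmin_pos; auto|]; intros w Hw.
  generalize (D w (Rlt_le_trans _ _ _ Hw (Rmin_l _ _)))
    (D' w (Rlt_le_trans _ _ _ Hw (Rmin_r _ _))).
  replace (f w + g w - (f z + g z)) with ((f w - f z) + (g w - g z)) by ring.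
  generalize (Cmod_triangle (f w - f z) (g w - g z)); lra.
Qed.

Lemma cont_scal {K} (i f : K -> C) c z :
  cont i f z -> cont i (fun w => c * f w) z.
Proof.
  intros Hf; apply (cont_comp i f (fun w => c * w)); auto.
  exact (is_der_cont _ _ _ _ (holo_scal c (f z))).
Qed.

Lemma cont_opp {K} (i f : K -> C) z : cont i f z -> cont i (fun w => - f w) z.
Proof.
  intros H; apply cont_ext with (fun w => - (1) * f w); [intros; ring|].
  now apply cont_scal.
Qed.

Lemma cont_minus {K} (i f g : K -> C) z :
  cont i f z -> cont i g z -> cont i (fun w => f w - g w) z.
Proof. intros Hf Hg; apply cont_plus; auto; now apply cont_opp. Qed.

Lemma cont_mult {K} (i f g : K -> C) z :
  cont i f z -> cont i g z -> cont i (fun w => f w * g w) z.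
Proof.
  intros Hf Hg.
  apply cont_ext with
    (fun w => / 4 * ((f w + g w) * (f w + g w) - (f w - g w) * (f w - g w)));
    [intros; field; intro E; injection E; lra|].
  apply cont_scal, cont_minus.
  - apply (cont_comp i (fun w => f w + g w) (fun w => w * w));
      [exact (is_der_cont _ _ _ _ (holo_sqr _)) | now apply cont_plus].
  - apply (cont_comp i (fun w => f w - g w) (fun w => w * w));
      [exact (is_der_cont _ _ _ _ (holo_sqr _)) | now apply cont_minus].
Qed.

Lemma cont_inv {K} (i f : K -> C) z :
  f z <> 0 -> cont i f z -> cont i (fun w => / f w) z.
Proof.
  intros Hz Hf; apply (cont_comp i f Cinv); auto.
  clear Hf i; revert Hz; generalize (f z) as a; intros a Ha eps He.
  assert (Hm := proj1 (Cmod_gt_0 a) Ha).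
  set (m := Cmod a) in *.
  (* The first bound keeps [Cmod w] above [m / 2], so that the denominator [w * a] has modulus above
     [m * m / 2]. *)
  exists (Rmin (m / 2) (eps * (m * m / 2)))%R; split.
  { apply Rmin_pos; [lra | apply Rmult_lt_0_compat; nra]. }
  intros w Hw.
  assert (H1 := Rlt_le_trans _ _ _ Hw (Rmin_l _ _)).
  assert (H2 := Rlt_le_trans _ _ _ Hw (Rmin_r _ _)).
  assert (Hw2 : (m / 2 < Cmod w)%R).
  { generalize (Cmod_le_plus_sub a w); rewrite (Cmod_sub_sym a); fold m; lra. }
  assert (Hw0 : w <> 0) by (apply Cmod_gt_0; lra).
  replace (/ w - / a) with ((a - w) / (w * a)) by (field; auto).
  rewrite Cmod_div, Cmod_mult, (Cmod_sub_sym a); [|now apply Cmult_neq_0].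
  fold m; apply Rlt_div_l; [nra|].
  assert (0 < eps * m)%R by nra; nra.
Qed.

Lemma holo_unique (f : C -> C) z l m : holo f z l -> holo f z m -> l = m.
Proof.
  intros Hl Hm; apply Ceq_minus, Cmod_eq_0.
  apply Rle_antisym; [|apply Cmod_ge_0]; apply Rnot_lt_le; intro Hp.
  set (e := Cmod (l - m)) in *.
  destruct (Hl (e / 4)%R) as [d [Hd D]]; [lra|].
  destruct (Hm (e / 4)%R) as [d' [Hd' D']]; [lra|].
  assert (Hdd : (0 < Rmin d d')%R) by (apply Rmin_pos; auto).
  set (h := (Rmin d d' / 2)%R) in *.
  assert (Hh : Cmod (z + h - z) = h).
  { replace (z + h - z) with (RtoC h) by ring.
    rewrite Cmod_R; apply Rabs_pos_eq; unfold h; lra. }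
  generalize (Rmin_l d d') (Rmin_r d d'); intros Hn1 Hn2.
  assert (Ha := D (z + h)); assert (Hb := D' (z + h)).
  rewrite Hh in Ha, Hb.
  specialize (Ha ltac:(unfold h; lra)); specialize (Hb ltac:(unfold h; lra)).
  assert (Hc : (Cmod (h * (l - m)) <= e / 4 * h + e / 4 * h)%R).
  { replace (h * (l - m)) with
      ((f (z + h) - f z - (z + h - z) * m) - (f (z + h) - f z - (z + h - z) * l))
      by ring.
    eapply Rle_trans; [apply Cmod_triangle_sub|]; lra. }
  rewrite Cmod_mult, Cmod_R, Rabs_pos_eq in Hc by (unfold h; lra).
  fold e in Hc; assert (0 < h)%R by (unfold h; lra); nra.
Qed.

(** * Comparison with the notions of Coquelicot *)

Lemma ex_derive_holo (f : C -> C) (z : C) :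
  ex_derive (K := C_AbsRing) (V := C_NormedModule) f z -> holo f z (C_derive f z).
Proof.
  intros H; apply C_derive_correct in H; [|exact z].
  destruct H as [_ H]; intros eps He.
  (* The estimate inside [is_derive] is indexed by the limits of the neighbourhood filter, and [z]
     is one of them. *)
  destruct (H z (fun P HP => HP) (mkposreal eps He)) as [d D].
  exists d; split; [apply cond_pos|]; intros w Hw.
  exact (D w Hw).
Qed.

Lemma holo_is_derive (f : C -> C) (z l : C) :
  holo f z l -> is_derive (K := C_AbsRing) (V := C_NormedModule) f z l.
Proof.
  intros H; split; [apply is_linear_scal_l|].
  intros x Hx; assert (E : z = x) by
    exact (is_filter_lim_locally_unique (V := AbsRing_NormedModule C_AbsRing) z x Hx).
  subst x.
  intros eps; destruct (H eps (cond_pos eps)) as [d [Hd D]].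
  exists (mkposreal d Hd); intros w Hw; exact (D w Hw).
Qed.

Lemma holo_C_derive (f : C -> C) (z l : C) : holo f z l -> C_derive f z = l.
Proof.
  intros H; apply (holo_unique f z); [|exact H].
  apply ex_derive_holo; exists l; now apply holo_is_derive.
Qed.

Lemma RtoC_sub_mod (s t : R) : Cmod (RtoC s - RtoC t) = Rabs (s - t).
Proof. rewrite <- RtoC_minus; apply Cmod_R. Qed.

Lemma path_der_is_derive (f : R -> C) (t : R) (l : C) :
  path_der f t l -> is_derive (K := R_AbsRing) (V := C_R_NormedModule) f t l.
Proof.
  intros H; split; [apply is_linear_scal_l|].
  intros x Hx; assert (E : t = x) by
    exact (is_filter_lim_locally_unique (V := AbsRing_NormedModule R_AbsRing) t x Hx).
  subst x.
  intros eps; destruct (H eps (cond_pos eps)) as [d [Hd D]].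
  exists (mkposreal d Hd); intros w Hw.
  rewrite <- Cmod_norm, scal_R_Cmult.
  specialize (D w); rewrite RtoC_sub_mod in D; specialize (D Hw).
  rewrite <- RtoC_minus in D; exact D.
Qed.

Lemma is_derive_path_der (f : R -> C) (t : R) (l : C) :
  is_derive (K := R_AbsRing) (V := C_R_NormedModule) f t l -> path_der f t l.
Proof.
  intros [_ H] eps He.
  destruct (H t (fun P HP => HP) (mkposreal eps He)) as [d D].
  exists d; split; [apply cond_pos|]; intros w Hw.
  rewrite RtoC_sub_mod in *; specialize (D w Hw).
  rewrite <- Cmod_norm, scal_R_Cmult in D.
  rewrite <- RtoC_minus; exact D.
Qed.

Lemma cont_continuous (f : R -> C) (t : R) :
  cont RtoC f t -> continuous (U := C_R_NormedModule) f t.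
Proof.
  intros H; apply filterlim_locally; intros eps.
  destruct (H eps (cond_pos eps)) as [d [Hd D]].
  exists (mkposreal d Hd); intros w Hw.
  specialize (D w); rewrite RtoC_sub_mod in D; specialize (D Hw).
  apply C_NormedModule_mixin_compat1; exact D.
Qed.

(** * Mean value inequality and complex exponential *)

Lemma path_der_Re (f : R -> C) (t : R) (l : C) :
  path_der f t l -> is_derive (fun s => Re (f s)) t (Re l).
Proof.
  intros H; apply is_derive_Reals; intros eps He.
  destruct (H (eps / 2)%R) as [d [Hd D]]; [lra|].
  exists (mkposreal d Hd); intros h Hh0 Hh; simpl in Hh.
  specialize (D (t + h)%R); rewrite RtoC_sub_mod in D.
  replace (t + h - t)%R with h in D by ring; specialize (D Hh).
  rewrite <- RtoC_minus in D; replace (t + h - t)%R with h in D by ring.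
  assert (Hp := Rabs_pos_lt h Hh0).
  replace ((Re (f (t + h)%R) - Re (f t)) / h - Re l)%R with
    (Re (f (t + h)%R - f t - h * l) / h)%R.
  - rewrite Rabs_div by auto; apply Rlt_div_l; [lra|].
    generalize (re_le_Cmod (f (t + h)%R - f t - h * l)); nra.
  - destruct (f (t + h)%R), (f t), l; simpl; field; auto.
Qed.

Lemma path_der_pair (p q : R -> R) (t dp dq : R) :
  is_derive p t dp -> is_derive q t dq ->
  path_der (fun s => (p s, q s)) t (dp, dq).
Proof.
  intros Hp Hq eps He; apply is_derive_Reals in Hp, Hq.
  destruct (Hp (eps / 2)%R) as [d D]; [lra|].
  destruct (Hq (eps / 2)%R) as [d' D']; [lra|].
  exists (Rmin d d'); split; [apply Rmin_pos; apply cond_pos|]; intros s Hs.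
  rewrite RtoC_sub_mod in *.
  destruct (Req_dec (s - t) 0) as [E|E].
  { replace s with t by lra.
    match goal with |- (Cmod ?a <= _)%R => replace a with (RtoC 0) by ring end.
    rewrite Cmod_0, Rminus_diag, Rabs_R0; lra. }
  specialize (D (s - t)%R E (Rlt_le_trans _ _ _ Hs (Rmin_l _ _))).
  specialize (D' (s - t)%R E (Rlt_le_trans _ _ _ Hs (Rmin_r _ _))).
  replace (t + (s - t))%R with s in * by ring.
  assert (Hst := Rabs_pos_lt _ E).
  assert (B : forall (r : R -> R) (dr : R),
    (Rabs ((r s - r t) / (s - t) - dr) < eps / 2)%R ->
    (Rabs (r s - r t - (s - t) * dr) <= eps / 2 * Rabs (s - t))%R).
  { intros r dr Hr.
    replace (r s - r t - (s - t) * dr)%R with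
      (((r s - r t) / (s - t) - dr) * (s - t))%R by (field; auto).
    rewrite Rabs_mult; nra. }
  replace ((p s, q s) - (p t, q t) - (s - t) * (dp, dq)) with
    (RtoC (p s - p t - (s - t) * dp)%R + Ci * RtoC (q s - q t - (s - t) * dq)%R).
  - eapply Rle_trans; [apply Cmod_triangle|].
    rewrite Cmod_mult, Cmod_Ci, !Cmod_R.
    generalize (B p dp D) (B q dq D'); lra.
  - apply injective_projections; simpl; ring.
Qed.

(** For complex values the mean value theorem survives only as an inequality. The comparison
    function [phi] need not be linear, so that exponential decay of a derivative can be integrated
    in [ex_tail_int]. *)
Lemma mean_value_le (G dG : R -> C) (phi dphi : R -> R) (a b : R) :
  (a <= b)%R ->
  (forall t, (a <= t <= b)%R -> path_der G t (dG t)) ->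
  (forall t, (a <= t <= b)%R -> is_derive phi t (dphi t)) ->
  (forall t, (a <= t <= b)%R -> Cmod (dG t) <= dphi t) ->
  Cmod (G b - G a) <= phi b - phi a.
Proof.
  intros Hab HG Hphi Hle.
  (* Test against the unit direction [c] that makes [c (G b - G a)] real. *)
  set (v := G b - G a).
  assert (Hc : exists c : C, (Cmod c <= 1)%R /\ Re (c * v) = Cmod v).
  { destruct (Ceq_dec v 0) as [E|E].
    - exists 0; rewrite E, Cmult_0_r, Cmod_0; simpl; lra.
    - assert (Hv := proj1 (Cmod_gt_0 v) E).
      exists (Cconj v / Cmod v); split.
      + rewrite Cmod_div, Cmod_conj, Cmod_R, Rabs_pos_eq;
          [right; field; lra | lra | intro A; injection A; lra].
      + replace (Cconj v / Cmod v * v) with (v * Cconj v / Cmod v)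
          by (field; intro A; injection A; lra).
        rewrite <- Cmod2_conj, <- RtoC_div by lra.
        simpl; field; lra. }
  destruct Hc as [c [Hc1 Hc2]].
  destruct (MVT_gen (fun t => phi t - Re (c * G t))%R a b
    (fun t => dphi t - Re (c * dG t))%R) as [xi [Hxi E]].
  - rewrite Rmin_left, Rmax_right by lra; intros t Ht.
    apply is_derive_Reals, derivable_pt_lim_minus; apply is_derive_Reals.
    + apply Hphi; lra.
    + apply (path_der_Re (fun s => c * G s)), is_der_scal, HG; lra.
  - rewrite Rmin_left, Rmax_right by lra; intros t Ht.
    apply continuity_pt_minus; apply derivable_continuous_pt.
    + exists (dphi t); apply is_derive_Reals, Hphi, Ht.
    + exists (Re (c * dG t)); apply is_derive_Reals, (path_der_Re (fun s => c * G s)), is_der_scal, HG, Ht.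
  - rewrite Rmin_left, Rmax_right in Hxi by lra.
    assert (Hd : (0 <= dphi xi - Re (c * dG xi))%R).
    { generalize (re_le_Cmod (c * dG xi)) (Hle xi Hxi) (Cmod_ge_0 (dG xi))
        (Rle_abs (Re (c * dG xi))) (Cmod_ge_0 c).
      rewrite Cmod_mult; nra. }
    assert (Hr : Re (c * v) = (Re (c * G b) - Re (c * G a))%R).
    { unfold v; destruct c, (G a), (G b); simpl; ring. }
    rewrite Hc2 in Hr; nra.
Qed.

Lemma mean_value_lipschitz (G dG : R -> C) (M a b : R) :
  (a <= b)%R ->
  (forall t, (a <= t <= b)%R -> path_der G t (dG t)) ->
  (forall t, (a <= t <= b)%R -> Cmod (dG t) <= M) ->
  Cmod (G b - G a) <= M * (b - a).
Proof.
  intros Hab HG HM; replace (M * (b - a))%R with (M * b - M * a)%R by ring.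
  apply (mean_value_le G dG (fun t => M * t)%R (fun _ => M)); auto.
  intros t _; auto_derive; auto; ring.
Qed.

Lemma path_der_zero_const (G : R -> C) (a b : R) :
  (a <= b)%R -> (forall t, (a <= t <= b)%R -> path_der G t 0) -> G b = G a.
Proof.
  intros Hab HG; apply Ceq_minus, Cmod_eq_0, Rle_antisym; [|apply Cmod_ge_0].
  replace 0%R with (0 * (b - a))%R by ring.
  apply (mean_value_lipschitz G (fun _ => 0)); auto.
  intros t _; rewrite Cmod_0; lra.
Qed.

Lemma path_der_line (z h : C) (t : R) : path_der (fun s : R => z + s * h) t h.
Proof.
  apply is_der_eq with (0 + (1 * h + t * 0)); [|ring].
  apply is_der_plus; [apply is_der_const|].
  apply is_der_mult; [apply is_der_incl | apply is_der_const].
Qed.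

Lemma holo_line (f : C -> C) (z h : C) (t : R) (l : C) :
  holo f (z + t * h) l -> path_der (fun s : R => f (z + s * h)) t (l * h).
Proof.
  intros H; apply (is_der_comp RtoC (fun s : R => z + s * h)); auto.
  apply path_der_line.
Qed.

Lemma holo_lipschitz (f f' : C -> C) (z h : C) (M : R) :
  (forall t, (0 <= t <= 1)%R -> holo f (z + t * h) (f' (z + t * h))) ->
  (forall t, (0 <= t <= 1)%R -> Cmod (f' (z + t * h)) <= M) ->
  Cmod (f (z + h) - f z) <= M * Cmod h.
Proof.
  intros Hf HM.
  assert (H := mean_value_lipschitz (fun t : R => f (z + t * h))
    (fun t : R => f' (z + t * h) * h) (M * Cmod h) 0 1 Rle_0_1).
  rewrite Rminus_0_r, Rmult_1_r, Cmult_0_l, Cmult_1_l, Cplus_0_r in H; apply H.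
  - intros t Ht; now apply holo_line, Hf.
  - intros t Ht; rewrite Cmod_mult; apply Rmult_le_compat_r;
      [apply Cmod_ge_0 | auto].
Qed.

Lemma holo_affine_error (f f' : C -> C) (z h l : C) (M : R) :
  (forall t, (0 <= t <= 1)%R -> holo f (z + t * h) (f' (z + t * h))) ->
  (forall t, (0 <= t <= 1)%R -> Cmod (f' (z + t * h) - l) <= M) ->
  Cmod (f (z + h) - f z - h * l) <= M * Cmod h.
Proof.
  intros Hf HM.
  replace (f (z + h) - f z - h * l) with
    ((f (z + h) - l * (z + h)) - (f z - l * z)) by ring.
  apply (holo_lipschitz (fun w => f w - l * w) (fun w => f' w - l)); auto.
  intros t Ht; apply is_der_minus; auto; apply holo_scal.
Qed.

(** Two nested Lipschitz estimates, for [f'] and then for [f] minus its affine part, give [M] in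
    place of the sharp [M / 2]; only the quadratic order in [h] matters. *)
Lemma holo_taylor2 (f f' f'' : C -> C) (z h : C) (M : R) :
  (forall t, (0 <= t <= 1)%R -> holo f (z + t * h) (f' (z + t * h))) ->
  (forall t, (0 <= t <= 1)%R -> holo f' (z + t * h) (f'' (z + t * h))) ->
  (forall t, (0 <= t <= 1)%R -> Cmod (f'' (z + t * h)) <= M) ->
  Cmod (f (z + h) - f z - h * f' z) <= M * Cmod h * Cmod h.
Proof.
  intros Hf Hf' HM.
  apply holo_affine_error with f'; auto; intros t Ht.
  assert (HM0 : (0 <= M)%R).
  { eapply Rle_trans; [apply Cmod_ge_0 | apply (HM 0%R); lra]. }
  apply Rle_trans with (M * Cmod (t * h))%R.
  - apply holo_lipschitz with f''.
    + intros s Hs; assert (Hst : (0 <= s * t <= 1)%R)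
        by (split; [apply Rmult_le_pos | rewrite <- (Rmult_1_r 1);
          apply Rmult_le_compat]; lra).
      replace (z + s * (t * h)) with (z + (s * t)%R * h)
        by (rewrite RtoC_mult; ring).
      apply Hf', Hst.
    + intros s Hs; assert (Hst : (0 <= s * t <= 1)%R)
        by (split; [apply Rmult_le_pos | rewrite <- (Rmult_1_r 1);
          apply Rmult_le_compat]; lra).
      replace (z + s * (t * h)) with (z + (s * t)%R * h)
        by (rewrite RtoC_mult; ring).
      apply HM, Hst.
  - rewrite Cmod_mult, Cmod_R, Rabs_pos_eq by lra.
    assert (H := Rmult_le_pos _ _ HM0 (Cmod_ge_0 h)); nra.
Qed.

(** * The complex exponential *)

Lemma exp_le_compat (a b : R) : (a <= b)%R -> (exp a <= exp b)%R.
Proof.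
  intros [H| ->]; [left; now apply exp_increasing | apply Rle_refl].
Qed.

Lemma Cexp_plus (a b : C) : Cexp (a + b) = Cexp a * Cexp b.
Proof.
  unfold Cexp; destruct a as [a1 a2], b as [b1 b2]; simpl.
  rewrite exp_plus, cos_plus, sin_plus.
  apply injective_projections; simpl; ring.
Qed.

Lemma Cexp_0 : Cexp 0 = 1.
Proof.
  unfold Cexp; simpl; rewrite exp_0, cos_0, sin_0.
  apply injective_projections; simpl; ring.
Qed.

Lemma Cmod_Cexp (a : C) : Cmod (Cexp a) = exp (Re a).
Proof.
  destruct a as [a b]; unfold Cmod, Cexp; simpl.
  transitivity (sqrt (exp a * exp a));
    [f_equal | apply sqrt_square; left; apply exp_pos].
  generalize (sin2_cos2 b); unfold Rsqr; intros H.
  transitivity (exp a * exp a * (sin b * sin b + cos b * cos b))%R; [ring|].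
  rewrite H; ring.
Qed.

Lemma Cexp_neq_0 (a : C) : Cexp a <> 0.
Proof. apply Cmod_gt_0; rewrite Cmod_Cexp; apply exp_pos. Qed.

Lemma Cexp_opp (a : C) : Cexp (- a) = / Cexp a.
Proof.
  assert (H : Cexp a * Cexp (- a) = 1)
    by (rewrite <- Cexp_plus, Cplus_opp_r; apply Cexp_0).
  rewrite <- (Cmult_1_l (/ Cexp a)), <- H; field; apply Cexp_neq_0.
Qed.

Lemma path_der_Cexp (h : C) (t : R) :
  path_der (fun s : R => Cexp (s * h)) t (h * Cexp (t * h)).
Proof.
  destruct h as [a b].
  apply is_der_ext with
    (fun s => (exp (s * a) * cos (s * b), exp (s * a) * sin (s * b))%R).
  { intros s; unfold Cexp; simpl.
    replace (s * a - 0 * b)%R with (s * a)%R by ring.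
    now replace (s * b + 0 * a)%R with (s * b)%R by ring. }
  apply is_der_eq with
    ((a * exp (t * a) * cos (t * b) - exp (t * a) * (b * sin (t * b)))%R,
     (a * exp (t * a) * sin (t * b) + exp (t * a) * (b * cos (t * b)))%R).
  - apply path_der_pair; auto_derive; auto; ring.
  - unfold Cexp; simpl.
    replace (t * a - 0 * b)%R with (t * a)%R by ring.
    replace (t * b + 0 * a)%R with (t * b)%R by ring.
    apply injective_projections; simpl; ring.
Qed.

Lemma Cmod_Cexp_sub_1 (h : C) (t : R) :
  (0 <= t <= 1)%R -> (Cmod (Cexp (t * h) - 1) <= Cmod h * exp (Cmod h))%R.
Proof.
  intros Ht.
  assert (H := mean_value_lipschitz (fun s : R => Cexp (s * h))
    (fun s : R => h * Cexp (s * h)) (Cmod h * exp (Cmod h)) 0 t (proj1 Ht)).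
  simpl in H; rewrite Cmult_0_l, Cexp_0 in H.
  eapply Rle_trans; [apply H|].
  - intros s _; apply path_der_Cexp.
  - intros s Hs; rewrite Cmod_mult, Cmod_Cexp.
    apply Rmult_le_compat_l; [apply Cmod_ge_0|].
    apply exp_le_compat; rewrite re_scal_l.
    generalize (re_le_Cmod h) (Rle_abs (Re h)) (Cmod_ge_0 h); nra.
  - assert (0 <= Cmod h * exp (Cmod h))%R
      by (apply Rmult_le_pos; [apply Cmod_ge_0 | left; apply exp_pos]); nra.
Qed.

(** The addition formula reduces everything to [Cexp h - 1 - h] for small [h]. On the ray [s * h]
    the exponential is a path with known real components, and integrating its derivative twice
    bounds this remainder quadratically. *)
Lemma holo_Cexp (z : C) : holo Cexp z (Cexp z).
Proof.
  intros eps He.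
  set (A := (Cmod (Cexp z) * exp 1)%R).
  assert (HA : (0 <= A)%R)
    by (apply Rmult_le_pos; [apply Cmod_ge_0 | left; apply exp_pos]).
  exists (Rmin 1 (eps / (A + 1)))%R; split.
  { apply Rmin_pos; [lra | apply Rdiv_lt_0_compat; lra]. }
  intros w Hw.
  assert (H1 := Rlt_le_trans _ _ _ Hw (Rmin_l _ _)).
  assert (H2 := Rlt_le_trans _ _ _ Hw (Rmin_r _ _)).
  apply Rlt_div_r in H2; [|lra].
  set (h := w - z) in *.
  replace (Cexp w - Cexp z - h * Cexp z) with (Cexp z * (Cexp h - 1 - h)).
  2:{ replace w with (z + h) by (unfold h; ring); rewrite Cexp_plus; ring. }
  assert (HE : (Cmod (Cexp h - 1 - h) <= Cmod h * exp (Cmod h) * Cmod h)%R).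
  { assert (H := mean_value_lipschitz (fun s : R => Cexp (s * h) - s * h)
      (fun s : R => h * Cexp (s * h) - h)
      (Cmod h * exp (Cmod h) * Cmod h) 0 1 Rle_0_1).
    simpl in H; rewrite !Cmult_0_l, !Cmult_1_l, Cexp_0, Rminus_0_r, Rmult_1_r in H.
    replace (Cexp h - 1 - h) with (Cexp h - h - (1 - 0)) by ring; apply H.
    - intros t _; apply is_der_minus; [apply path_der_Cexp|].
      apply is_der_ext with (fun s : R => 0 + s * h); [intros; ring|].
      apply path_der_line.
    - intros t Ht; replace (h * Cexp (t * h) - h) with ((Cexp (t * h) - 1) * h)
        by ring.
      rewrite Cmod_mult; apply Rmult_le_compat_r; [apply Cmod_ge_0|].
      now apply Cmod_Cexp_sub_1. }
  rewrite Cmod_mult.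
  assert (He1 : (exp (Cmod h) <= exp 1)%R) by (apply exp_le_compat; lra).
  assert (Hh := Cmod_ge_0 h); assert (Hz := Cmod_ge_0 (Cexp z)).
  assert (Hk : (Cmod h * exp (Cmod h) * Cmod h <= exp 1 * (Cmod h * Cmod h))%R)
    by nra.
  apply Rle_trans with (A * (Cmod h * Cmod h))%R; [|nra].
  unfold A; rewrite Rmult_assoc; apply Rmult_le_compat_l; lra.
Qed.

Lemma is_der_Cexp {K : Type} (i f : K -> C) (z : K) (l : C) :
  is_der i f z l -> is_der i (fun w => Cexp (f w)) z (Cexp (f z) * l).
Proof. apply is_der_comp, holo_Cexp. Qed.

Lemma cont_Cexp {K : Type} (i f : K -> C) (z : K) :
  cont i f z -> cont i (fun w => Cexp (f w)) z.
Proof. apply cont_comp; exact (is_der_cont _ _ _ _ (holo_Cexp _)). Qed.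

(** * Integrals of paths *)

Definition Cint (f : R -> C) (a b : R) : C :=
  RInt (V := C_R_CompleteNormedModule) f a b.

Lemma is_RInt_path_der (G g : R -> C) (a b : R) :
  (a <= b)%R ->
  (forall t, (a <= t <= b)%R -> path_der G t (g t)) ->
  (forall t, (a <= t <= b)%R -> cont RtoC g t) ->
  is_RInt (V := C_R_CompleteNormedModule) g a b (G b - G a).
Proof.
  intros Hab HG Hg.
  refine (is_RInt_derive (V := C_R_CompleteNormedModule) G g _ _ _ _);
    rewrite Rmin_left, Rmax_right by lra; intros t Ht.
  - now apply path_der_is_derive, HG.
  - now apply cont_continuous, Hg.
Qed.

Lemma Cint_path_der (G g : R -> C) (a b : R) :
  (forall t, path_der G t (g t)) -> (forall t, cont RtoC g t) ->
  Cint g a b = G b - G a.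
Proof.
  intros HG Hg; apply (is_RInt_unique (V := C_R_CompleteNormedModule)).
  refine (is_RInt_derive (V := C_R_CompleteNormedModule) G g _ _ _ _); intros t _.
  - now apply path_der_is_derive.
  - now apply cont_continuous.
Qed.

(** With a primitive at hand, linearity, additivity and bounds for [Cint] become algebra of
    end-point values through [Cint_path_der]. *)
Lemma path_primitive (g : R -> C) :
  (forall t, cont RtoC g t) -> exists G, forall t, path_der G t (g t).
Proof.
  intros Hg; exists (fun t => Cint g 0 t); intros t.
  apply is_derive_path_der, (is_derive_RInt (V := C_R_CompleteNormedModule)) with 0%R.
  - apply filter_forall; intros s.
    apply (RInt_correct (V := C_R_CompleteNormedModule)).
    apply (ex_RInt_continuous (V := C_R_CompleteNormedModule)).
    intros u _; now apply cont_continuous.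
  - now apply cont_continuous.
Qed.

Lemma Cint_plus (f g : R -> C) (a b : R) :
  (forall t, cont RtoC f t) -> (forall t, cont RtoC g t) ->
  Cint (fun t => f t + g t) a b = Cint f a b + Cint g a b.
Proof.
  intros Hf Hg; destruct (path_primitive f Hf) as [F HF].
  destruct (path_primitive g Hg) as [G HG].
  rewrite (Cint_path_der F f), (Cint_path_der G g) by auto.
  rewrite (Cint_path_der (fun t => F t + G t) (fun t => f t + g t)); [ring| |].
  - intros t; now apply is_der_plus.
  - intros t; now apply cont_plus.
Qed.

Lemma Cint_scal (c : C) (f : R -> C) (a b : R) :
  (forall t, cont RtoC f t) -> Cint (fun t => c * f t) a b = c * Cint f a b.
Proof.
  intros Hf; destruct (path_primitive f Hf) as [F HF].
  rewrite (Cint_path_der F f) by auto.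
  rewrite (Cint_path_der (fun t => c * F t) (fun t => c * f t)); [ring| |].
  - intros t; now apply is_der_scal.
  - intros t; now apply cont_scal.
Qed.

Lemma Cint_minus (f g : R -> C) (a b : R) :
  (forall t, cont RtoC f t) -> (forall t, cont RtoC g t) ->
  Cint (fun t => f t - g t) a b = Cint f a b - Cint g a b.
Proof.
  intros Hf Hg; destruct (path_primitive f Hf) as [F HF].
  destruct (path_primitive g Hg) as [G HG].
  rewrite (Cint_path_der F f), (Cint_path_der G g) by auto.
  rewrite (Cint_path_der (fun t => F t - G t) (fun t => f t - g t)); [ring| |].
  - intros t; now apply is_der_minus.
  - intros t; now apply cont_minus.
Qed.

Lemma Cint_chasles (f : R -> C) (a b c : R) :
  (forall t, cont RtoC f t) -> Cint f a b + Cint f b c = Cint f a c.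
Proof.
  intros Hf; destruct (path_primitive f Hf) as [F HF].
  rewrite !(Cint_path_der F f) by auto; ring.
Qed.

Lemma Cint_const (c : C) (a b : R) : Cint (fun _ => c) a b = (b - a) * c.
Proof.
  rewrite (Cint_path_der (fun t : R => 0 + t * c) (fun _ => c)); [ring| |].
  - intros t; apply path_der_line.
  - intros t; apply cont_const.
Qed.

Lemma Cint_ext (f g : R -> C) (a b : R) :
  (forall t, f t = g t) -> Cint f a b = Cint g a b.
Proof. intros H; apply (RInt_ext (V := C_R_CompleteNormedModule)); auto. Qed.

Lemma Cint_bound (f : R -> C) (a b M : R) :
  (a <= b)%R -> (forall t, cont RtoC f t) ->
  (forall t, (a <= t <= b)%R -> Cmod (f t) <= M) ->
  (Cmod (Cint f a b) <= M * (b - a))%R.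
Proof.
  intros Hab Hf HM; destruct (path_primitive f Hf) as [F HF].
  rewrite (Cint_path_der F f) by auto.
  apply mean_value_lipschitz with f; auto.
Qed.

(** * Bisection of rectangles *)

Lemma nested_intervals (a b : nat -> R) :
  (forall n, a n <= a (S n) /\ b (S n) <= b n) -> (forall n, a n <= b n) ->
  exists x, forall n, a n <= x <= b n.
Proof.
  intros Hm Hab.
  assert (Ha : forall n k, a n <= a (n + k)%nat).
  { intros n; induction k as [|k IH]; [rewrite Nat.add_0_r; lra|].
    rewrite Nat.add_succ_r; generalize (Hm (n + k)%nat); lra. }
  assert (Hb : forall n k, b (n + k)%nat <= b n).
  { intros n; induction k as [|k IH]; [rewrite Nat.add_0_r; lra|].
    rewrite Nat.add_succ_r; generalize (Hm (n + k)%nat); lra. }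
  assert (Hle : forall n m, a n <= b m).
  { intros n m; generalize (Ha n m) (Hb m n) (Hab (n + m)%nat).
    rewrite (Nat.add_comm m n); lra. }
  destruct (completeness (fun y => exists n, y = a n)) as [x [Hx1 Hx2]].
  - exists (b 0%nat); intros y [n ->]; apply Hle.
  - exists (a 0%nat), 0%nat; reflexivity.
  - exists x; intros n; split.
    + apply Hx1; now exists n.
    + apply Hx2; intros y [m ->]; apply Hle.
Qed.

(** If the property failed, it would fail on some quarter, then on a quarter of this quarter, and so
    on; the failing rectangles shrink to a point, where the local hypothesis is contradicted. The
    same principle yields Goursat's theorem and the compactness of discs. *)
Lemma rect_induction (P : R -> R -> R -> R -> Prop) :
  (forall a b c d, a <= b -> c <= d ->
     P a ((a + b) / 2)%R c ((c + d) / 2)%R ->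
     P ((a + b) / 2)%R b c ((c + d) / 2)%R ->
     P a ((a + b) / 2)%R ((c + d) / 2)%R d ->
     P ((a + b) / 2)%R b ((c + d) / 2)%R d -> P a b c d) ->
  (forall x y, exists e, 0 < e /\ forall a b c d,
     a <= x <= b -> c <= y <= d -> b - a < e -> d - c < e -> P a b c d) ->
  forall a b c d, a <= b -> c <= d -> P a b c d.
Proof.
  intros Hsplit Hloc a b c d Hab Hcd.
  apply NNPP; intros HnP.
  (* Passes to the first quarter on which [P] fails; when three of them satisfy [P], the invariant
     below shows that the fourth does not. *)
  set (step := fun s : (R * R) * (R * R) =>
    let '((a, b), (c, d)) := s in
    let m := ((a + b) / 2)%R in let n := ((c + d) / 2)%R in
    if excluded_middle_informative (P a m c n) then
      if excluded_middle_informative (P m b c n) then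
        if excluded_middle_informative (P a m n d) then ((m, b), (n, d))
        else ((a, m), (n, d))
      else ((m, b), (c, n))
    else ((a, m), (c, n))).
  set (sq := fun n => Nat.iter n step ((a, b), (c, d))).
  set (u := fun n => fst (fst (sq n))); set (v := fun n => snd (fst (sq n))).
  set (p := fun n => fst (snd (sq n))); set (q := fun n => snd (snd (sq n))).
  assert (Hinv : forall n, u n <= v n /\ p n <= q n /\ ~ P (u n) (v n) (p n) (q n)
    /\ (v n - u n = (b - a) * (/ 2) ^ n)%R /\ (q n - p n = (d - c) * (/ 2) ^ n)%R).
  { intros n; induction n as [|n IH]; [unfold u, v, p, q, sq; simpl; repeat split; auto; ring|].
    unfold u, v, p, q in *; change (sq (S n)) with (step (sq n)).
    destruct (sq n) as [[a' b'] [c' d']]; simpl in *.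
    destruct IH as [H1 [H2 [H3 [H4 H5]]]].
    destruct (excluded_middle_informative _) as [P1|P1]; simpl;
      [|repeat split; try lra; auto].
    destruct (excluded_middle_informative _) as [P2|P2]; simpl;
      [|repeat split; try lra; auto].
    destruct (excluded_middle_informative _) as [P3|P3]; simpl;
      [|repeat split; try lra; auto].
    repeat split; try lra; intros P4; apply H3, Hsplit; auto. }
  assert (Hmono : forall n, (u n <= u (S n) /\ v (S n) <= v n)
    /\ (p n <= p (S n) /\ q (S n) <= q n)).
  { intros n; destruct (Hinv n) as [H1 [H2 _]].
    unfold u, v, p, q in *; change (sq (S n)) with (step (sq n)).
    destruct (sq n) as [[a' b'] [c' d']]; simpl in *.
    repeat (destruct (excluded_middle_informative _); simpl; [|lra]); lra. }
  destruct (nested_intervals u v) as [x Hx];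
    [intros n; apply Hmono | intros n; apply Hinv |].
  destruct (nested_intervals p q) as [y Hy];
    [intros n; apply Hmono | intros n; apply Hinv |].
  destruct (Hloc x y) as [e [He HP]].
  (* The denominator exceeds both side lengths and stays positive for a degenerate rectangle. *)
  destruct (pow_lt_1_zero (/ 2) ltac:(rewrite Rabs_pos_eq; lra)
    (e / ((b - a) + (d - c) + 1))%R) as [N HN].
  { apply Rdiv_lt_0_compat; lra. }
  specialize (HN N (Nat.le_refl N)).
  assert (H2 : 0 < (/ 2) ^ N) by (apply pow_lt; lra).
  rewrite Rabs_pos_eq in HN by lra; apply Rlt_div_r in HN; [|lra].
  destruct (Hinv N) as [_ [_ [H3 [H4 H5]]]]; apply H3, HP; auto;
    [rewrite H4 | rewrite H5]; nra.
Qed.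

(** * Uniform estimates on discs *)

Lemma Cmod_le_Re_Im (x y : R) : Cmod (x + Ci * y) <= Rabs x + Rabs y.
Proof.
  eapply Rle_trans; [apply Cmod_triangle|].
  rewrite Cmod_mult, Cmod_Ci, !Cmod_R; lra.
Qed.

Lemma C_Re_Im (z : C) : z = Re z + Ci * Im z.
Proof. destruct z; apply injective_projections; simpl; ring. Qed.

(** Compactness, run on the square around the disc: since [Q] is inherited by smaller constants, the
    least of the four constants found on the quarters serves on their union. *)
Lemma locally_uniform (Q : C -> R -> Prop) :
  (forall w d d', 0 < d' <= d -> Q w d -> Q w d') ->
  (forall p, exists d, 0 < d /\ forall w, Cmod (w - p) < d -> Q w d) ->
  forall M, exists d, 0 < d /\ forall w, Cmod w <= M -> Q w d.
Proof.
  intros Hanti Hloc M.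
  set (P := fun a b c d : R => exists e, 0 < e /\
    forall w, a <= Re w <= b -> c <= Im w <= d -> Q w e).
  assert (H : P (- Rabs M)%R (Rabs M) (- Rabs M)%R (Rabs M)).
  { apply rect_induction; try (generalize (Rabs_pos M); lra).
    - intros a b c d _ _ [e1 [He1 H1]] [e2 [He2 H2]] [e3 [He3 H3]] [e4 [He4 H4]].
      set (e12 := Rmin e1 e2); set (e34 := Rmin e3 e4).
      assert (L12 : 0 < e12) by (now apply Rmin_pos).
      assert (L34 : 0 < e34) by (now apply Rmin_pos).
      assert (L : 0 < Rmin e12 e34) by (now apply Rmin_pos).
      exists (Rmin e12 e34); split; auto; intros w Ha Hc.
      generalize (Rmin_l e12 e34) (Rmin_r e12 e34) (Rmin_l e1 e2) (Rmin_r e1 e2)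
        (Rmin_l e3 e4) (Rmin_r e3 e4); fold e12 e34; intros.
      destruct (Rle_dec (Re w) ((a + b) / 2)), (Rle_dec (Im w) ((c + d) / 2));
        [apply (Hanti w e1) | apply (Hanti w e3) | apply (Hanti w e2)
        | apply (Hanti w e4)]; try lra;
        [apply H1 | apply H3 | apply H2 | apply H4]; lra.
    - intros x y; destruct (Hloc (x + Ci * y)) as [d [Hd H]].
      exists (d / 2)%R; split; [lra|]; intros a b c e Ha Hc Hb He.
      exists d; split; auto; intros w Hwa Hwc; apply H.
      rewrite (C_Re_Im w) at 1.
      replace (Re w + Ci * Im w - (x + Ci * y)) with
        ((Re w - x)%R + Ci * (Im w - y)%R) by (rewrite !RtoC_minus; ring).
      eapply Rle_lt_trans; [apply Cmod_le_Re_Im|].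
      apply Rle_lt_trans with ((b - a) + (e - c))%R; [|lra].
      apply Rplus_le_compat; apply Rabs_le; lra. }
  destruct H as [e [He H]]; exists e; split; auto; intros w Hw; apply H.
  - generalize (re_le_Cmod w) (Rle_abs M) (Rle_abs (Re w)) (Rle_abs (- Re w)).
    rewrite Rabs_Ropp; lra.
  - generalize (Im_le_Cmod w) (Rle_abs M) (Rle_abs (Im w)) (Rle_abs (- Im w)).
    rewrite Rabs_Ropp; lra.
Qed.

Notation ccont := (cont (fun z : C => z)).

Lemma ccont_bounded (f : C -> C) (M : R) :
  (forall z, ccont f z) ->
  exists B, 0 < B /\ forall w, Cmod w <= M -> Cmod (f w) <= B.
Proof.
  intros Hf.
  (* The inverse turns an upper bound into a condition that smaller [d] inherit. *)
  destruct (locally_uniform (fun w d => Cmod (f w) <= / d)) with M as [d [Hd H]].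
  - intros w d d' Hd H; eapply Rle_trans; [exact H|].
    apply Rinv_le_contravar; lra.
  - intros p; destruct (Hf p 1%R Rlt_0_1) as [d [Hd H]].
    assert (Hp := Cmod_ge_0 (f p)).
    exists (Rmin d (/ (1 + Cmod (f p)))); split.
    { apply Rmin_pos; auto; apply Rinv_0_lt_compat; lra. }
    intros w Hw; specialize (H w (Rlt_le_trans _ _ _ Hw (Rmin_l _ _))).
    apply Rle_trans with (1 + Cmod (f p))%R.
    + generalize (Cmod_le_plus_sub (f w) (f p)); lra.
    + rewrite <- (Rinv_inv (1 + Cmod (f p))) at 1.
      apply Rinv_le_contravar; [|apply Rmin_r].
      apply Rmin_pos; auto; apply Rinv_0_lt_compat; lra.
  - exists (/ d)%R; split; auto; now apply Rinv_0_lt_compat.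
Qed.

Lemma ccont_unif (f : C -> C) (M eps : R) :
  (forall z, ccont f z) -> 0 < eps ->
  exists d, 0 < d /\ forall w k, Cmod w <= M -> Cmod k < d ->
    Cmod (f (w + k) - f w) <= eps.
Proof.
  intros Hf He.
  destruct (locally_uniform (fun w d => forall k, Cmod k < d ->
    Cmod (f (w + k) - f w) <= eps)) with M as [d [Hd H]].
  - intros w d d' Hd H k Hk; apply H; lra.
  - intros p; destruct (Hf p (eps / 2)%R) as [d [Hd H]]; [lra|].
    (* One half of [d] is spent on the distance from [w] to [p], the other on the shift [k]. *)
    exists (d / 2)%R; split; [lra|]; intros w Hw k Hk.
    replace (f (w + k) - f w) with ((f (w + k) - f p) - (f w - f p)) by ring.
    eapply Rle_trans; [apply Cmod_triangle_sub|].
    assert (Hwk : Cmod (w + k - p) < d).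
    { replace (w + k - p) with ((w - p) + k) by ring.
      eapply Rle_lt_trans; [apply Cmod_triangle|]; lra. }
    generalize (H _ Hwk) (H w ltac:(lra)); lra.
  - exists d; split; auto.
Qed.

(** Uniformity in the base point is what differentiation under an integral sign consumes; continuity
    of [f'] is supplied later by [holo_derivative]. *)
Lemma holo_unif (f f' : C -> C) (M eps : R) :
  (forall z, holo f z (f' z)) -> (forall z, ccont f' z) -> 0 < eps ->
  exists d, 0 < d /\ forall w k, Cmod w <= M -> Cmod k < d ->
    Cmod (f (w + k) - f w - k * f' w) <= eps * Cmod k.
Proof.
  intros Hf Hf' He; destruct (ccont_unif f' M eps Hf' He) as [d [Hd H]].
  exists d; split; auto; intros w k Hw Hk.
  apply holo_affine_error with f'; auto; intros t Ht; apply H; auto.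
  rewrite Cmod_mult, Cmod_R, Rabs_pos_eq by lra.
  generalize (Cmod_ge_0 k); nra.
Qed.

(** * Goursat's theorem *)

Definition rect_int (g : C -> C) (a b c d : R) : C :=
  Cint (fun s => g (s + Ci * c)) a b + Ci * Cint (fun t => g (b + Ci * t)) c d
  - Cint (fun s => g (s + Ci * d)) a b - Ci * Cint (fun t => g (a + Ci * t)) c d.

Lemma path_der_hor (y t : R) : path_der (fun s : R => s + Ci * y) t 1.
Proof.
  apply is_der_eq with (1 + 0); [|ring].
  apply is_der_plus; [apply is_der_incl | apply is_der_const].
Qed.

Lemma path_der_ver (x t : R) : path_der (fun s : R => x + Ci * s) t Ci.
Proof.
  apply is_der_eq with (0 + Ci * 1); [|ring].
  apply is_der_plus; [apply is_der_const | apply is_der_scal, is_der_incl].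
Qed.

Lemma cont_hor (g : C -> C) (y t : R) :
  (forall z, ccont g z) -> cont RtoC (fun s : R => g (s + Ci * y)) t.
Proof.
  intros Hg; apply (cont_comp RtoC (fun s : R => s + Ci * y)); auto.
  exact (is_der_cont _ _ _ _ (path_der_hor y t)).
Qed.

Lemma cont_ver (g : C -> C) (x t : R) :
  (forall z, ccont g z) -> cont RtoC (fun s : R => g (x + Ci * s)) t.
Proof.
  intros Hg; apply (cont_comp RtoC (fun s : R => x + Ci * s)); auto.
  exact (is_der_cont _ _ _ _ (path_der_ver x t)).
Qed.

Lemma rect_int_minus (f g : C -> C) (a b c d : R) :
  (forall z, ccont f z) -> (forall z, ccont g z) ->
  rect_int (fun z => f z - g z) a b c d = rect_int f a b c d - rect_int g a b c d.
Proof.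
  intros Hf Hg; unfold rect_int.
  rewrite !(Cint_minus (fun s => f (s + Ci * _)) (fun s => g (s + Ci * _)))
    by (intros; now apply cont_hor).
  rewrite !(Cint_minus (fun t => f (_ + Ci * t)) (fun t => g (_ + Ci * t)))
    by (intros; now apply cont_ver).
  ring.
Qed.

Lemma Ci_sqr : Ci * Ci = - (1).
Proof. apply injective_projections; simpl; ring. Qed.

Lemma rect_int_primitive (G g : C -> C) (a b c d : R) :
  (forall z, holo G z (g z)) -> (forall z, ccont g z) -> rect_int g a b c d = 0.
Proof.
  intros HG Hg; unfold rect_int.
  assert (Hh : forall y : R, Cint (fun s : R => g (s + Ci * y)) a b
    = G (b + Ci * y) - G (a + Ci * y)).
  { intros y; apply (Cint_path_der (fun s : R => G (s + Ci * y))).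
    - intros t; apply is_der_eq with (g (t + Ci * y) * 1); [|ring].
      apply (is_der_comp RtoC (fun s : R => s + Ci * y)); auto.
      apply path_der_hor.
    - intros t; now apply cont_hor. }
  assert (Hv : forall x : R, Cint (fun t : R => g (x + Ci * t)) c d
    = - Ci * G (x + Ci * d) - (- Ci * G (x + Ci * c))).
  { intros x; apply (Cint_path_der (fun t : R => - Ci * G (x + Ci * t))).
    - intros t; apply is_der_eq with (- Ci * (g (x + Ci * t) * Ci)).
      + apply is_der_scal, (is_der_comp RtoC (fun s : R => x + Ci * s)); auto.
        apply path_der_ver.
      + transitivity (- (Ci * Ci) * g (x + Ci * t)); [ring|].
        rewrite Ci_sqr; ring.
    - intros t; now apply cont_ver. }
  rewrite !Hh, !Hv.
  replace (Ci * (- Ci * G (b + Ci * d) - - Ci * G (b + Ci * c))) with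
    (- (Ci * Ci) * (G (b + Ci * d) - G (b + Ci * c))) by ring.
  replace (Ci * (- Ci * G (a + Ci * d) - - Ci * G (a + Ci * c))) with
    (- (Ci * Ci) * (G (a + Ci * d) - G (a + Ci * c))) by ring.
  rewrite Ci_sqr; ring.
Qed.

Lemma rect_int_bound (g : C -> C) (a b c d M : R) :
  a <= b -> c <= d -> (forall z, ccont g z) ->
  (forall z, a <= Re z <= b -> c <= Im z <= d -> Cmod (g z) <= M) ->
  Cmod (rect_int g a b c d) <= 2 * M * ((b - a) + (d - c)).
Proof.
  intros Hab Hcd Hg HM.
  assert (HM' : forall x y : R, a <= x <= b -> c <= y <= d ->
    Cmod (g (x + Ci * y)) <= M).
  { intros x y Hx Hy; apply HM; simpl; lra. }
  assert (Hh : forall y : R, c <= y <= d ->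
    Cmod (Cint (fun s => g (s + Ci * y)) a b) <= M * (b - a)).
  { intros y Hy; apply Cint_bound; auto; intros t; now apply cont_hor. }
  assert (Hv : forall x : R, a <= x <= b ->
    Cmod (Cint (fun t => g (x + Ci * t)) c d) <= M * (d - c)).
  { intros x Hx; apply Cint_bound; auto; intros t; now apply cont_ver. }
  unfold rect_int.
  match goal with |- Cmod (?A + Ci * ?B - ?D - Ci * ?E) <= _ =>
    generalize (Cmod_triangle_sub (A + Ci * B - D) (Ci * E))
      (Cmod_triangle_sub (A + Ci * B) D) (Cmod_triangle A (Ci * B));
    rewrite (Cmod_mult Ci B), (Cmod_mult Ci E), Cmod_Ci
  end.
  generalize (Hh c ltac:(lra)) (Hh d ltac:(lra)) (Hv a ltac:(lra)) (Hv b ltac:(lra)).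
  lra.
Qed.

Lemma rect_int_split (g : C -> C) (a m b c n d : R) :
  (forall z, ccont g z) ->
  rect_int g a b c d = rect_int g a m c n + rect_int g m b c n
    + rect_int g a m n d + rect_int g m b n d.
Proof.
  intros Hg; unfold rect_int.
  rewrite <- !(Cint_chasles (fun s => g (s + Ci * _)) a m b)
    by (intros; now apply cont_hor).
  rewrite <- !(Cint_chasles (fun t => g (_ + Ci * t)) c n d)
    by (intros; now apply cont_ver).
  ring.
Qed.

(** Near a point, [g] differs from its affine part by little compared with the distance, and the
    affine part [l] has a primitive; hence the integral over a small rectangle is at most [eps]
    times the square of the sum of its sides. This bound passes from the quarters to the whole with
    the same [eps]: four quarters, each with a quarter of the square. *)
Lemma goursat (g g' : C -> C) (a b c d : R) :
  (forall z, holo g z (g' z)) -> a <= b -> c <= d -> rect_int g a b c d = 0.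
Proof.
  intros Hg Hab Hcd.
  assert (Hc : forall z, ccont g z)
    by (intros z; exact (is_der_cont _ _ _ _ (Hg z))).
  assert (Hsmall : forall eps, 0 < eps ->
    Cmod (rect_int g a b c d) <= eps * ((b - a) + (d - c)) ^ 2).
  { intros eps He.
    apply (rect_induction (fun a b c d =>
      Cmod (rect_int g a b c d) <= eps * ((b - a) + (d - c)) ^ 2)); auto.
    - clear a b c d Hab Hcd; intros a b c d _ _ H1 H2 H3 H4.
      rewrite (rect_int_split g a ((a + b) / 2) b c ((c + d) / 2) d) by auto.
      eapply Rle_trans; [apply Cmod_triangle|].
      eapply Rle_trans; [apply Rplus_le_compat_r, Cmod_triangle|].
      eapply Rle_trans; [do 2 apply Rplus_le_compat_r; apply Cmod_triangle|].
      replace (eps * (b - a + (d - c)) ^ 2)%R with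
        (4 * (eps * ((b - a + (d - c)) / 2) ^ 2))%R by field.
      replace ((b - a + (d - c)) / 2)%R with
        ((a + b) / 2 - a + ((c + d) / 2 - c))%R by field.
      replace (b - (a + b) / 2)%R with ((a + b) / 2 - a)%R in * by field.
      replace (d - (c + d) / 2)%R with ((c + d) / 2 - c)%R in * by field.
      lra.
    - clear a b c d Hab Hcd; intros x y; set (p := x + Ci * y).
      destruct (Hg p (eps / 2)%R) as [e [He' D]]; [lra|].
      exists (e / 2)%R; split; [lra|]; intros a b c d Ha Hc' Hb Hd.
      set (l := fun z => g p + (z - p) * g' p).
      assert (Hl : forall z, ccont l z).
      { intros z; apply cont_plus; [apply cont_const|].
        apply cont_mult; [|apply cont_const].
        apply cont_minus; [apply cont_incl | apply cont_const]. }
      assert (E : rect_int g a b c d = rect_int (fun z => g z - l z) a b c d).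
      { rewrite rect_int_minus by auto.
        rewrite (rect_int_primitive
          (fun z => g p * z + / 2 * g' p * ((z - p) * (z - p))) l); [ring| |auto].
        intros z; apply is_der_eq with
          (g p + / 2 * g' p * (1 * (z - p) + (z - p) * 1)).
        - apply is_der_plus; [apply holo_scal|].
          apply is_der_scal.
          assert (Hz : holo (fun w => w - p) z 1).
          { apply is_der_eq with (1 - 0); [|ring].
            apply is_der_minus; [apply is_der_incl | apply is_der_const]. }
          apply (is_der_mult (fun w : C => w) (fun w => w - p) (fun w => w - p));
            auto.
        - unfold l; field; intro A; injection A; lra. }
      rewrite E.
      replace (eps * (b - a + (d - c)) ^ 2)%R with
        (2 * (eps / 2 * ((b - a) + (d - c))) * ((b - a) + (d - c)))%R by field.
      apply rect_int_bound; try lra.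
      + intros z; apply cont_minus; auto.
      + intros z Hza Hzc.
        assert (Hz : Cmod (z - p) <= (b - a) + (d - c)).
        { rewrite (C_Re_Im z) at 1; unfold p.
          replace (Re z + Ci * Im z - (x + Ci * y)) with
            ((Re z - x)%R + Ci * (Im z - y)%R) by (rewrite !RtoC_minus; ring).
          eapply Rle_trans; [apply Cmod_le_Re_Im|].
          apply Rplus_le_compat; apply Rabs_le; lra. }
        unfold l; replace (g z - (g p + (z - p) * g' p)) with
          (g z - g p - (z - p) * g' p) by ring.
        eapply Rle_trans; [apply D; lra|].
        apply Rmult_le_compat_l; lra. }
  apply Cmod_eq_0, Rle_antisym; [|apply Cmod_ge_0].
  apply Rnot_lt_le; intros Hp.
  set (S := (((b - a) + (d - c)) ^ 2)%R) in *.
  assert (HS : 0 <= S) by (apply pow2_ge_0).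
  (* For this [eps] the integral is bounded by itself times a factor below [1]; the summand [1]
     covers [S = 0]. *)
  assert (H := Hsmall (Cmod (rect_int g a b c d) / (2 * (S + 1)))%R).
  specialize (H ltac:(apply Rdiv_lt_0_compat; lra)).
  replace (Cmod (rect_int g a b c d) / (2 * (S + 1)) * S)%R with
    (Cmod (rect_int g a b c d) * (S / (2 * (S + 1))))%R in H by (field; lra).
  assert (S / (2 * (S + 1)) < 1) by (apply Rlt_div_l; lra).
  nra.
Qed.

(** * Regularity of entire functions *)

Lemma path_der_RtoC (t : R) : path_der (fun s : R => s) t 1.
Proof. exact (is_der_incl RtoC t). Qed.

Lemma Cexp_2PI (u : C) : Cexp (u + Ci * (2 * PI)%R) = Cexp u.
Proof.
  destruct u as [a b]; unfold Cexp; simpl.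
  replace (b + (0 * 0 + 1 * (2 * PI)))%R with (b + 2 * PI)%R by ring.
  replace (a + (0 * (2 * PI) - 1 * 0))%R with a by ring.
  rewrite (cos_plus b), (sin_plus b), cos_2PI, sin_2PI.
  apply injective_projections; simpl; ring.
Qed.

Lemma Cint_Cexp_circle (s : R) :
  Cint (fun t => Cexp (- (s + Ci * t))) 0 (2 * PI) = 0.
Proof.
  rewrite (Cint_path_der (fun t : R => Ci * Cexp (- (s + Ci * t)))
    (fun t : R => Cexp (- (s + Ci * t)))).
  - replace (- (s + Ci * 0%R)) with (- (s + Ci * (2 * PI)%R) + Ci * (2 * PI)%R)
      by ring.
    rewrite Cexp_2PI; ring.
  - intros t; apply is_der_eq with (Ci * (Cexp (- (s + Ci * t)) * - Ci)).
    + apply is_der_scal.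
      apply (is_der_Cexp RtoC (fun t : R => - (s + Ci * t))), is_der_opp.
      apply path_der_ver.
    + transitivity (- (Ci * Ci) * Cexp (- (s + Ci * t))); [ring|].
      rewrite Ci_sqr; ring.
  - intros t; apply (cont_Cexp RtoC (fun t : R => - (s + Ci * t))), cont_opp.
    exact (is_der_cont _ _ _ _ (path_der_ver s t)).
Qed.

(** The integral is the one over a vertical side of length [2 PI] of a
    rectangle for [u |-> f (z + e^u) e^(-u)]; by periodicity and Goursat it does
    not depend on the abscissa of this side, which tends to [-oo]. *)
Lemma cauchy_derivative (f f' : C -> C) (z : C) :
  (forall w, holo f w (f' w)) ->
  Cint (fun t => f (z + Cexp (Ci * t)) * Cexp (- (Ci * t))) 0 (2 * PI)
    = (2 * PI)%R * f' z.
Proof.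
  intros Hf.
  set (g := fun u => f (z + Cexp u) * Cexp (- u)).
  set (g' := fun u => f' (z + Cexp u) * Cexp u * Cexp (- u)
    + f (z + Cexp u) * (Cexp (- u) * - (1))).
  assert (Hg : forall u, holo g u (g' u)).
  { intros u.
    apply (is_der_mult (fun w : C => w) (fun u => f (z + Cexp u)) (fun u => Cexp (- u))).
    - apply (is_der_comp (fun w : C => w) (fun u => z + Cexp u)); auto.
      apply is_der_eq with (0 + Cexp u); [|ring].
      apply is_der_plus; [apply is_der_const | apply holo_Cexp].
    - apply (is_der_Cexp (fun w : C => w) (fun u => - u)), is_der_opp.
      apply is_der_incl. }
  assert (Hgc : forall u, ccont g u)
    by (intros u; exact (is_der_cont _ _ _ _ (Hg u))).
  set (V := fun s : R => Cint (fun t => g (s + Ci * t)) 0 (2 * PI)).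
  assert (HPI := PI_RGT_0).
  assert (HV : forall s : R, s <= 0 -> V s = V 0%R).
  { intros s Hs.
    assert (H := goursat g g' s 0 0 (2 * PI) Hg Hs ltac:(lra)).
    unfold rect_int in H.
    (* By periodicity the two horizontal sides cancel. *)
    rewrite (Cint_ext (fun t : R => g (t + Ci * (2 * PI)%R))
      (fun t : R => g (t + Ci * 0))) in H.
    - fold (V s) (V 0%R) in H.
      assert (E : - (Ci * Ci) * (V 0%R - V s) = - Ci * 0).
      { transitivity (- Ci * (Ci * (V 0%R - V s))); [ring|].
        f_equal; etransitivity; [|exact H]; ring. }
      rewrite Ci_sqr in E; symmetry; apply Ceq_minus.
      transitivity (- - (1) * (V 0%R - V s)); [ring|].
      rewrite E; ring.
    - intros t; unfold g.
      replace (- (t + Ci * (2 * PI)%R)) with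
        (- (t + Ci * 0) + Ci * - (2 * PI)%R) by ring.
      replace (t + Ci * (2 * PI)%R) with (t + Ci * 0 + Ci * (2 * PI)%R) by ring.
      rewrite Cexp_2PI; f_equal.
      rewrite <- (Cexp_2PI (_ + Ci * - (2 * PI)%R)); f_equal; ring. }
  transitivity (V 0%R).
  { apply Cint_ext; intros t; unfold g; now rewrite Cplus_0_l. }
  apply Ceq_minus, Cmod_eq_0, Rle_antisym; [|apply Cmod_ge_0].
  apply le_epsilon; intros e He; rewrite Rplus_0_l.
  set (eps := (e / (2 * PI))%R).
  assert (Heps : 0 < eps) by (apply Rdiv_lt_0_compat; lra).
  destruct (Hf z eps Heps) as [d [Hd D]].
  (* Puts the circle of radius [exp s] about [z] inside the disc where the estimate [D] holds; the
     minimum with [0] allows [HV] to be applied. *)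
  set (s := Rmin 0 (ln (d / 2))).
  rewrite <- (HV s) by apply Rmin_l.
  assert (Hs : exp s < d).
  { apply Rle_lt_trans with (exp (ln (d / 2))).
    - apply exp_le_compat, Rmin_r.
    - rewrite exp_ln; lra. }
  (* This is [g] with [f] replaced by its affine part at [z]: over a period the first term
     integrates to zero and the second gives the claimed value. *)
  set (k := fun u => f z * Cexp (- u) + f' z).
  assert (Hkc : forall u, ccont k u).
  { intros u; apply cont_plus; [|apply cont_const].
    apply cont_mult; [apply cont_const|].
    apply (cont_Cexp (fun w : C => w) (fun u => - u)), cont_opp, cont_incl. }
  assert (Hk : Cint (fun t => k (s + Ci * t)) 0 (2 * PI) = (2 * PI)%R * f' z).
  { unfold k.
    rewrite (Cint_plus (fun t : R => f z * Cexp (- (s + Ci * t))) (fun _ => f' z)).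
    - rewrite (Cint_scal (f z) (fun t : R => Cexp (- (s + Ci * t)))).
      + rewrite Cint_Cexp_circle, Cint_const; ring.
      + intros t; apply (cont_ver (fun u => Cexp (- u))); intros u.
        apply (cont_Cexp (fun w : C => w) (fun u => - u)), cont_opp, cont_incl.
    - intros t; apply cont_mult; [apply cont_const|].
      apply (cont_ver (fun u => Cexp (- u))); intros u.
      apply (cont_Cexp (fun w : C => w) (fun u => - u)), cont_opp, cont_incl.
    - intros t; apply cont_const. }
  rewrite <- Hk; unfold V.
  rewrite <- (Cint_minus (fun t : R => g (s + Ci * t)) (fun t : R => k (s + Ci * t)))
    by (intros t; now apply cont_ver).
  replace e with (eps * (2 * PI - 0))%R by (unfold eps; field; lra).
  apply Cint_bound; [lra| |].
  { intros t; apply cont_minus; now apply cont_ver. }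
  intros t _; set (u := s + Ci * t); unfold g, k.
  assert (Hinv : Cexp u * Cexp (- u) = 1)
    by (rewrite <- Cexp_plus, Cplus_opp_r; apply Cexp_0).
  replace (f (z + Cexp u) * Cexp (- u) - (f z * Cexp (- u) + f' z)) with
    ((f (z + Cexp u) - f z - Cexp u * f' z) * Cexp (- u)).
  2:{ transitivity (f (z + Cexp u) * Cexp (- u) - f z * Cexp (- u)
        - (Cexp u * Cexp (- u)) * f' z); [ring | rewrite Hinv; ring]. }
  assert (Hu : Cmod (Cexp u) = exp s).
  { rewrite Cmod_Cexp; f_equal; unfold u; simpl; ring. }
  assert (Hu' : Cmod (Cexp (- u)) = exp (- s)).
  { rewrite Cmod_Cexp; f_equal; unfold u; simpl; ring. }
  specialize (D (z + Cexp u)).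
  replace (z + Cexp u - z) with (Cexp u) in D by ring.
  rewrite Hu in D; specialize (D Hs).
  rewrite Cmod_mult, Hu'.
  apply Rle_trans with (eps * exp s * exp (- s))%R.
  - apply Rmult_le_compat_r; auto; left; apply exp_pos.
  - rewrite Rmult_assoc, <- exp_plus, Rplus_opp_r, exp_0; lra.
Qed.

(** * Integrals depending on a parameter, and their consequences *)

(** The weights cover both the Cauchy integral ([q = 1], with [p] and [r] on the unit circle) and
    the radial primitive ([p = 1], [q t = t], [r = 0]). Bounding them by one keeps all arguments of
    [f] in the disc of radius [Cmod z + 1]. *)
Lemma ccont_param_int (f : C -> C) (p q r : R -> C) (a b : R) (z : C) :
  (forall w, ccont f w) -> a <= b ->
  (forall t, cont RtoC p t) -> (forall t, cont RtoC q t) ->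
  (forall t, cont RtoC r t) ->
  (forall t, a <= t <= b -> Cmod (p t) <= 1 /\ Cmod (q t) <= 1 /\ Cmod (r t) <= 1) ->
  ccont (fun z => Cint (fun t => p t * f (z * q t + r t)) a b) z.
Proof.
  intros Hf Hab Hp Hq Hr Hb eps He.
  assert (Hc : forall z t, cont RtoC (fun t => p t * f (z * q t + r t)) t).
  { intros y t; apply cont_mult; auto.
    apply (cont_comp RtoC (fun t => y * q t + r t)); auto.
    apply cont_plus; auto; apply cont_scal; auto. }
  set (e := (eps / (b - a + 1))%R).
  assert (He' : 0 < e) by (apply Rdiv_lt_0_compat; lra).
  destruct (ccont_unif f (Cmod z + 1) e Hf He') as [d [Hd D]].
  exists d; split; auto; intros w Hw.
  rewrite <- (Cint_minus (fun t => p t * f (w * q t + r t))) by auto.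
  apply Rle_lt_trans with (e * (b - a))%R.
  - apply Cint_bound; auto; [intros t; apply cont_minus; auto|].
    intros t Ht; destruct (Hb t Ht) as [B1 [B2 B3]].
    replace (p t * f (w * q t + r t) - p t * f (z * q t + r t)) with
      (p t * (f ((z * q t + r t) + (w - z) * q t) - f (z * q t + r t))).
    2:{ replace ((z * q t + r t) + (w - z) * q t) with (w * q t + r t) by ring.
        ring. }
    assert (Hz : Cmod (z * q t + r t) <= Cmod z + 1).
    { eapply Rle_trans; [apply Cmod_triangle|]; rewrite Cmod_mult.
      generalize (Cmod_ge_0 z); nra. }
    assert (Hk : Cmod ((w - z) * q t) < d).
    { rewrite Cmod_mult; generalize (Cmod_ge_0 (w - z)); nra. }
    specialize (D _ _ Hz Hk); rewrite Cmod_mult.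
    generalize (Cmod_ge_0 (p t))
      (Cmod_ge_0 (f (z * q t + r t + (w - z) * q t) - f (z * q t + r t))); nra.
  - unfold e; apply Rlt_le_trans with (eps / (b - a + 1) * (b - a + 1))%R.
    + apply Rmult_lt_compat_l; auto; lra.
    + right; field; lra.
Qed.

Lemma holo_param_int (f f' : C -> C) (p q r : R -> C) (a b : R) (z : C) :
  (forall w, holo f w (f' w)) -> (forall w, ccont f' w) -> a <= b ->
  (forall t, cont RtoC p t) -> (forall t, cont RtoC q t) ->
  (forall t, cont RtoC r t) ->
  (forall t, a <= t <= b -> Cmod (p t) <= 1 /\ Cmod (q t) <= 1 /\ Cmod (r t) <= 1) ->
  holo (fun z => Cint (fun t => p t * f (z * q t + r t)) a b) z
    (Cint (fun t => p t * q t * f' (z * q t + r t)) a b).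
Proof.
  intros Hf Hf' Hab Hp Hq Hr Hb eps He.
  assert (Hc : forall z t, cont RtoC (fun t => p t * f (z * q t + r t)) t).
  { intros y t; apply cont_mult; auto.
    apply (cont_comp RtoC (fun t => y * q t + r t)).
    - exact (is_der_cont _ _ _ _ (Hf _)).
    - apply cont_plus; auto; apply cont_scal; auto. }
  assert (Hc' : forall t, cont RtoC (fun t => p t * q t * f' (z * q t + r t)) t).
  { intros t; apply cont_mult; [apply cont_mult; auto|].
    apply (cont_comp RtoC (fun t => z * q t + r t)); auto.
    apply cont_plus; auto; apply cont_scal; auto. }
  set (e := (eps / (b - a + 1))%R).
  assert (He' : 0 < e) by (apply Rdiv_lt_0_compat; lra).
  destruct (holo_unif f f' (Cmod z + 1) e Hf Hf' He') as [d [Hd D]].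
  exists d; split; auto; intros w Hw.
  set (k := w - z) in *.
  rewrite <- (Cint_minus (fun t => p t * f (w * q t + r t))) by auto.
  rewrite <- (Cint_scal k) by auto.
  rewrite <- (Cint_minus
    (fun t => p t * f (w * q t + r t) - p t * f (z * q t + r t))).
  2:{ intros t; apply cont_minus; auto. }
  2:{ intros t; apply cont_scal; auto. }
  apply Rle_trans with (e * Cmod k * (b - a))%R.
  - apply Cint_bound; auto.
    { intros t; apply cont_minus; [apply cont_minus; auto|].
      apply cont_scal; auto. }
    intros t Ht; destruct (Hb t Ht) as [B1 [B2 B3]].
    set (y := z * q t + r t) in *.
    replace (p t * f (w * q t + r t) - p t * f y - k * (p t * q t * f' y)) with
      (p t * (f (y + k * q t) - f y - (k * q t) * f' y)).
    2:{ replace (w * q t + r t) with (y + k * q t) by (unfold y, k; ring). ring. }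
    assert (Hz : Cmod y <= Cmod z + 1).
    { unfold y; eapply Rle_trans; [apply Cmod_triangle|]; rewrite Cmod_mult.
      generalize (Cmod_ge_0 z); nra. }
    assert (Hkq : Cmod (k * q t) <= Cmod k).
    { rewrite Cmod_mult; generalize (Cmod_ge_0 k); nra. }
    specialize (D y (k * q t) Hz ltac:(lra)); rewrite Cmod_mult.
    assert (H0 := Cmod_ge_0 (f (y + k * q t) - f y - k * q t * f' y)).
    generalize (Cmod_ge_0 (p t)); nra.
  - assert (e * (b - a) <= eps).
    { apply Rle_trans with (e * (b - a + 1))%R; [apply Rmult_le_compat_l; lra|].
      right; unfold e; field; lra. }
    generalize (Cmod_ge_0 k); nra.
Qed.

(** The Cauchy integral expresses [f'] through values of [f] alone. It is used twice: continuity of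
    [f] gives continuity of [f'], and only then may the integral be differentiated, since
    [holo_param_int] asks for a continuous derivative. *)
Lemma holo_derivative (f f' : C -> C) :
  (forall z, holo f z (f' z)) -> exists f'', forall z, holo f' z (f'' z).
Proof.
  intros Hf; assert (HPI := PI_RGT_0).
  set (p := fun t : R => Cexp (- (Ci * t))); set (r := fun t : R => Cexp (Ci * t)).
  assert (Hpd : forall t, cont RtoC p t).
  { intros t; apply (cont_Cexp RtoC (fun t : R => - (Ci * t))), cont_opp.
    apply cont_scal, cont_incl. }
  assert (Hrd : forall t, cont RtoC r t).
  { intros t; apply (cont_Cexp RtoC (fun t : R => Ci * t)).
    apply cont_scal, cont_incl. }
  assert (Hb : forall t, 0 <= t <= 2 * PI ->
    Cmod (p t) <= 1 /\ Cmod 1 <= 1 /\ Cmod (r t) <= 1).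
  { intros t _; unfold p, r; rewrite !Cmod_Cexp, Cmod_1; simpl.
    replace (- (0 * t - 1 * 0))%R with 0%R by ring.
    replace (0 * t - 1 * 0)%R with 0%R by ring; rewrite exp_0; lra. }
  set (c := / (2 * PI)%R : C).
  assert (H2PI : RtoC (2 * PI)%R <> 0) by (intro A; injection A; lra).
  assert (E : forall g g' : C -> C, (forall z, holo g z (g' z)) -> forall z,
    c * Cint (fun t => p t * g (z * 1 + r t)) 0 (2 * PI) = g' z).
  { intros g g' Hg z.
    rewrite (Cint_ext _ (fun t : R => g (z + Cexp (Ci * t)) * Cexp (- (Ci * t)))).
    - rewrite (cauchy_derivative g g' z Hg); unfold c; field; auto.
    - intros t; unfold p, r; rewrite Cmult_1_r; ring. }
  assert (Hf'c : forall z, ccont f' z).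
  { intros z; apply cont_ext with
      (fun z => c * Cint (fun t => p t * f (z * 1 + r t)) 0 (2 * PI));
      [apply E, Hf|].
    apply cont_scal, (ccont_param_int f p (fun _ => 1) r); auto; try lra.
    - intros w; exact (is_der_cont _ _ _ _ (Hf w)).
    - intros t; apply cont_const. }
  exists (fun z => c * Cint (fun t => p t * 1 * f' (z * 1 + r t)) 0 (2 * PI)).
  intros z; apply is_der_ext with
    (fun z => c * Cint (fun t => p t * f (z * 1 + r t)) 0 (2 * PI));
    [apply E, Hf|].
  apply is_der_scal, (holo_param_int f f' p (fun _ => 1) r); auto; try lra.
  intros t; apply cont_const.
Qed.

(** The primitive is [z] times the mean of [f] over the segment from [0] to [z]. Its derivative is
    the integral of [f (z t) + z t f' (z t)], which is the derivative of [t f (z t)] in [t]. *)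
Lemma holo_primitive (f f' : C -> C) :
  (forall z, holo f z (f' z)) -> exists F, forall z, holo F z (f z).
Proof.
  intros Hf.
  assert (Hfc : forall z, ccont f z)
    by (intros z; exact (is_der_cont _ _ _ _ (Hf z))).
  destruct (holo_derivative f f' Hf) as [f'' Hf'].
  assert (Hf'c : forall z, ccont f' z)
    by (intros z; exact (is_der_cont _ _ _ _ (Hf' z))).
  set (p := fun _ : R => RtoC 1); set (r := fun _ : R => RtoC 0).
  exists (fun z => z * Cint (fun t => p t * f (z * t + r t)) 0 1); intros z.
  assert (Hl : forall t, path_der (fun s : R => z * s + r s) t z).
  { intros t; apply is_der_eq with (z * 1 + 0); [|ring].
    apply is_der_plus; [apply is_der_scal, is_der_incl | apply is_der_const]. }
  assert (Hlc : forall t, cont RtoC (fun s : R => z * s + r s) t)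
    by (intros t; exact (is_der_cont _ _ _ _ (Hl t))).
  apply is_der_eq with (1 * Cint (fun t => p t * f (z * t + r t)) 0 1
    + z * Cint (fun t => p t * t * f' (z * t + r t)) 0 1).
  - apply (is_der_mult (fun w : C => w) (fun w => w)
      (fun z => Cint (fun t => p t * f (z * t + r t)) 0 1)); [apply is_der_incl|].
    apply (holo_param_int f f' p RtoC r); auto; try lra;
      try (intros t; apply cont_const).
    + intros t; apply cont_incl.
    + intros t Ht; unfold p, r; rewrite Cmod_1, Cmod_0, Cmod_R, Rabs_pos_eq; lra.
  - rewrite Cmult_1_l, <- Cint_scal, <- Cint_plus.
    + rewrite (Cint_path_der (fun t : R => t * f (z * t + r t))).
      * rewrite Cmult_0_l, Cmult_1_r, Cmult_1_l; unfold r; rewrite Cplus_0_r; ring.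
      * intros t; apply is_der_eq with
          (1 * f (z * t + r t) + t * (f' (z * t + r t) * z)).
        -- apply (is_der_mult RtoC RtoC (fun t : R => f (z * t + r t)));
             [apply is_der_incl|].
           now apply (is_der_comp RtoC (fun s : R => z * s + r s)).
        -- unfold p; ring.
      * intros t; apply cont_plus.
        -- apply cont_mult; [apply cont_const|].
           now apply (cont_comp RtoC (fun s : R => z * s + r s)).
        -- apply cont_scal, cont_mult.
           ++ apply cont_mult; [apply cont_const | apply cont_incl].
           ++ now apply (cont_comp RtoC (fun s : R => z * s + r s)).
    + intros t; apply cont_mult; [apply cont_const|].
      now apply (cont_comp RtoC (fun s : R => z * s + r s)).
    + intros t; apply cont_scal, cont_mult.
      * apply cont_mult; [apply cont_const | apply cont_incl].
      * now apply (cont_comp RtoC (fun s : R => z * s + r s)).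
    + intros t; apply cont_mult.
      * apply cont_mult; [apply cont_const | apply cont_incl].
      * now apply (cont_comp RtoC (fun s : R => z * s + r s)).
Qed.

(** * Integrals of entire functions over ]-oo, 0] *)

Definition in_strip (u : C) : Prop := Re u <= 0 /\ Rabs (Im u) <= PI.

(** [l] is the integral of the entire function [F] over ]-oo, 0]; the estimate
    on a whole strip says that the path may end at [-oo + i y], [|y| <= PI]. *)
Definition is_tail_int (a : R) (F : C -> C) (l : C) : Prop :=
  exists (G : C -> C) (K : R), (forall u, holo G u (F u)) /\ 0 <= K /\
    forall u, in_strip u -> Cmod (G 0 - G u - l) <= K * exp (a * Re u).

Lemma exp_tail_small (a e : R) : 0 < a -> 0 < e -> exists s, s <= 0 /\
  forall t, t <= s -> exp (a * t) < e.
Proof.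
  intros Ha He; exists (Rmin 0 (ln (e / 2) / a)); split; [apply Rmin_l|].
  intros t Ht; apply Rle_lt_trans with (exp (ln (e / 2))).
  - apply exp_le_compat.
    assert (H : t <= ln (e / 2) / a) by (eapply Rle_trans; [exact Ht | apply Rmin_r]).
    apply Rle_div_r in H; lra.
  - rewrite exp_ln; lra.
Qed.

Lemma in_strip_RtoC (t : R) : t <= 0 -> in_strip t.
Proof.
  intros Ht; split; simpl; auto; rewrite Rabs_R0; generalize PI_RGT_0; lra.
Qed.

(** Transfers the bound that [ex_tail_int] gives for its own value to a value obtained otherwise,
    for instance by linearity. *)
Lemma is_tail_int_unique (a : R) (F : C -> C) (l m : C) :
  0 < a -> is_tail_int a F l -> is_tail_int a F m -> l = m.
Proof.
  intros Ha [G [K [HG [HK Hl]]]] [G' [K' [HG' [HK' Hm]]]].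
  apply Ceq_minus, Cmod_eq_0, Rle_antisym; [|apply Cmod_ge_0].
  apply le_epsilon; intros e He; rewrite Rplus_0_l.
  destruct (exp_tail_small a (e / (K + K' + 1))%R Ha) as [s [Hs H]].
  { apply Rdiv_lt_0_compat; lra. }
  specialize (H s (Rle_refl s)); apply Rlt_div_r in H; [|lra].
  assert (E : G s - G' s = G 0 - G' 0).
  { symmetry; apply (path_der_zero_const (fun t : R => G t - G' t) s 0 Hs).
    intros t _; apply is_der_eq with (F t * 1 - F t * 1); [|ring].
    apply is_der_minus; apply (is_der_comp RtoC RtoC); auto; apply path_der_RtoC. }
  specialize (Hl s (in_strip_RtoC s Hs)); specialize (Hm s (in_strip_RtoC s Hs)).
  simpl in Hl, Hm.
  replace (l - m) with ((G' 0 - G' s - m) - (G 0 - G s - l)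
    + ((G s - G' s) - (G 0 - G' 0)) * - (1)) by ring.
  rewrite E.
  replace (G 0 - G' 0 - (G 0 - G' 0)) with (RtoC 0) by ring.
  rewrite Cmult_0_l, Cplus_0_r.
  eapply Rle_trans; [apply Cmod_triangle_sub|].
  generalize (exp_pos (a * s)); nra.
Qed.

Lemma is_tail_int_minus (a : R) (F F' : C -> C) (l l' : C) :
  is_tail_int a F l -> is_tail_int a F' l' ->
  is_tail_int a (fun u => F u - F' u) (l - l').
Proof.
  intros [G [K [HG [HK Hl]]]] [G' [K' [HG' [HK' Hl']]]].
  exists (fun u => G u - G' u), (K + K')%R; split; [|split; [lra|]].
  - intros u; now apply is_der_minus.
  - intros u Hu.
    replace (G 0 - G' 0 - (G u - G' u) - (l - l')) with
      ((G 0 - G u - l) - (G' 0 - G' u - l')) by ring.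
    eapply Rle_trans; [apply Cmod_triangle_sub|].
    generalize (Hl u Hu) (Hl' u Hu); lra.
Qed.

Lemma is_tail_int_scal (a : R) (F : C -> C) (c l : C) :
  is_tail_int a F l -> is_tail_int a (fun u => c * F u) (c * l).
Proof.
  intros [G [K [HG [HK Hl]]]].
  exists (fun u => c * G u), (Cmod c * K)%R; split; [|split].
  - intros u; now apply is_der_scal.
  - apply Rmult_le_pos; auto; apply Cmod_ge_0.
  - intros u Hu; replace (c * G 0 - c * G u - c * l) with (c * (G 0 - G u - l))
      by ring.
    rewrite Cmod_mult, Rmult_assoc; apply Rmult_le_compat_l; auto.
    apply Cmod_ge_0.
Qed.

Lemma cauchy_at_m_infty (g : R -> C) :
  (forall e, 0 < e -> exists s, forall t t', t <= s -> t' <= s ->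
     Cmod (g t - g t') <= e) ->
  exists l, forall e, 0 < e -> exists s, forall t, t <= s -> Cmod (g t - l) <= e.
Proof.
  intros Hg.
  assert (FF : ProperFilter (Rbar_locally m_infty)) by apply Rbar_locally_filter.
  destruct (proj1 (filterlim_locally_cauchy (U := C_R_CompleteNormedModule) g))
    as [l Hl].
  - intros eps; destruct (Hg (eps / 2)%R) as [s Hs].
    { generalize (cond_pos eps); lra. }
    exists (fun t => t < s); split; [now exists s|].
    intros t t' Ht Ht'; apply C_NormedModule_mixin_compat1.
    apply Rle_lt_trans with (eps / 2)%R;
      [apply Hs; lra | generalize (cond_pos eps); lra].
  - exists l; intros e He.
    (* Balls of the product uniform structure control the components; passing to the modulus costs
       [sqrt 2]. *)
    assert (H2 : 0 < sqrt 2) by (apply sqrt_lt_R0; lra).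
    set (d := mkposreal (e / sqrt 2) (Rdiv_lt_0_compat _ _ He H2)).
    destruct (Hl (fun y => ball (M := C_UniformSpace) l d y)) as [s Hs].
    { exists d; auto. }
    exists (s - 1)%R; intros t Ht.
    left; apply Rlt_le_trans with (sqrt 2 * d)%R.
    + apply C_NormedModule_mixin_compat2, Hs; lra.
    + right; simpl; field; lra.
Qed.

(** From [u], move vertically to the real axis, over a length of at most [PI], then left to
    infinity, where integrating [exp (a t)] costs [/ a]; this explains the constant [/ a + PI]. The
    explicit bound on [l] is what later controls remainders. *)
Lemma ex_tail_int (a K : R) (F F' : C -> C) :
  0 < a -> 0 <= K -> (forall u, holo F u (F' u)) ->
  (forall u, in_strip u -> Cmod (F u) <= K * exp (a * Re u)) ->
  exists l, is_tail_int a F l /\ Cmod l <= K * (/ a + PI).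
Proof.
  intros Ha HK HF HB; destruct (holo_primitive F F' HF) as [G HG].
  assert (HPI := PI_RGT_0).
  assert (Hia := Rinv_0_lt_compat a Ha).
  assert (Hinc : forall s t, s <= t -> t <= 0 ->
    Cmod (G t - G s) <= K / a * exp (a * t)).
  { intros s t Hst Ht.
    apply Rle_trans with (K / a * exp (a * t) - K / a * exp (a * s))%R.
    - apply (mean_value_le (fun r : R => G r) (fun r : R => F r)
        (fun r => K / a * exp (a * r))%R (fun r => K * exp (a * r))%R); auto.
      + intros r _; apply is_der_eq with (F r * 1); [|ring].
        apply (is_der_comp RtoC RtoC); auto; apply path_der_RtoC.
      + intros r _; auto_derive; auto; field; lra.
      + intros r Hr; apply (HB r), in_strip_RtoC; lra.
    - assert (0 <= K / a * exp (a * s)); [|lra].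
      apply Rmult_le_pos; [apply Rmult_le_pos; lra | left; apply exp_pos]. }
  destruct (cauchy_at_m_infty (fun t => G t)) as [l Hl].
  { intros e He.
    destruct (exp_tail_small a (e / (K / a + 1))%R Ha) as [s [Hs H]].
    { apply Rdiv_lt_0_compat; auto; assert (0 <= K / a); [|lra].
      apply Rmult_le_pos; lra. }
    assert (Hka : 0 <= K / a) by (apply Rmult_le_pos; lra).
    exists s; intros t t' Ht Ht'.
    destruct (Rle_dec t t') as [Htt|Htt].
    - rewrite Cmod_sub_sym; eapply Rle_trans; [apply Hinc; lra|].
      specialize (H t' Ht'); apply Rlt_div_r in H; [|lra].
      generalize (exp_pos (a * t')); nra.
    - eapply Rle_trans; [apply Hinc; lra|].
      specialize (H t Ht); apply Rlt_div_r in H; [|lra].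
      generalize (exp_pos (a * t)); nra. }
  assert (Hreal : forall t, t <= 0 -> Cmod (G t - l) <= K / a * exp (a * t)).
  { intros t Ht; apply le_epsilon; intros e He.
    destruct (Hl e He) as [s Hs].
    specialize (Hs (Rmin s t) (Rmin_l s t)).
    specialize (Hinc (Rmin s t) t (Rmin_r s t) Ht).
    replace (G t - l) with ((G t - G (Rmin s t)) + (G (Rmin s t) - l)) by ring.
    eapply Rle_trans; [apply Cmod_triangle|]; lra. }
  assert (Hall : forall u, in_strip u ->
    Cmod (G u - l) <= K * (/ a + PI) * exp (a * Re u)).
  { intros u Hu; destruct Hu as [Hu1 Hu2].
    replace (G u - l) with ((G u - G (Re u)) + (G (Re u) - l)) by ring.
    eapply Rle_trans; [apply Cmod_triangle|].
    assert (Hv : Cmod (G u - G (Re u)) <= K * exp (a * Re u) * PI).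
    { replace u with (Re u + Ci * Im u) at 1 by (symmetry; apply C_Re_Im).
      apply Rle_trans with (K * exp (a * Re u) * Cmod (Ci * Im u))%R.
      - apply holo_lipschitz with F; auto; intros t Ht.
        replace (Re u) with (Re (Re u + t * (Ci * Im u))) at 2 by (simpl; ring).
        apply HB; split.
        + simpl; lra.
        + replace (Im (Re u + t * (Ci * Im u))) with (t * Im u)%R by (simpl; ring).
          rewrite Rabs_mult, (Rabs_pos_eq t) by lra.
          generalize (Rabs_pos (Im u)); nra.
      - rewrite Cmod_mult, Cmod_Ci, Cmod_R, Rmult_1_l.
        apply Rmult_le_compat_l; auto.
        apply Rmult_le_pos; auto; left; apply exp_pos. }
    generalize (Hreal (Re u) Hu1); unfold Rdiv; lra. }
  exists (G 0 - l); split.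
  - exists G, (K * (/ a + PI))%R; repeat split; auto.
    + apply Rmult_le_pos; lra.
    + intros u Hu; replace (G 0 - G u - (G 0 - l)) with (- (G u - l)) by ring.
      rewrite Cmod_opp; auto.
  - generalize (Hall 0 (in_strip_RtoC 0 (Rle_refl 0))); simpl.
    rewrite Rmult_0_r, exp_0; lra.
Qed.

Lemma path_der_real (phi : R -> R) (t d : R) :
  is_derive phi t d -> path_der (fun s => RtoC (phi s)) t d.
Proof.
  intros H; apply (path_der_pair phi (fun _ => 0%R) t d 0%R); auto.
  auto_derive; auto.
Qed.

Lemma path_der_ln (t : R) : 0 < t -> path_der (fun s : R => RtoC (ln s)) t (/ t)%R.
Proof. intros Ht; apply path_der_real; auto_derive; auto; field; lra. Qed.

(** The substitution [u = ln t]: if [G] is a primitive of [F], then [G (ln t)] is one of [m] on the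
    positive axis. *)
Lemma is_tail_int_RInt_gen (a : R) (F F' : C -> C) (m : R -> C) (l : C) :
  0 < a -> (forall u, holo F u (F' u)) -> is_tail_int a F l ->
  (forall t : R, 0 < t -> m t = F (ln t) / t) ->
  is_RInt_gen (V := C_R_NormedModule) m (at_right 0) (at_point 1) l.
Proof.
  intros Ha HF [G [K [HG [HK Hl]]]] Hm P [d HP].
  destruct (exp_tail_small a (d / (K + 1))%R Ha) as [s [Hs H]].
  { apply Rdiv_lt_0_compat; [apply cond_pos | lra]. }
  apply (Filter_prod _ _ _ (fun t => 0 < t <= exp s) (fun t => t = 1%R)).
  - exists (mkposreal _ (exp_pos s)); intros t Ht Ht0; split; auto.
    change (Rabs (t - 0) < exp s) in Ht.
    rewrite Rminus_0_r, Rabs_pos_eq in Ht; lra.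
  - reflexivity.
  - intros t t1 Ht ->; simpl.
    assert (Hln : ln t <= s).
    { rewrite <- (ln_exp s); destruct (proj2 Ht) as [Hlt| ->];
        [left; apply ln_increasing; lra | lra]. }
    assert (Ht1 : t <= 1).
    { apply Rle_trans with (exp s); [lra|].
      rewrite <- exp_0; now apply exp_le_compat. }
    exists (G (ln 1) - G (ln t)); split.
    + apply is_RInt_ext with (fun r : R => F (ln r) * RtoC (/ r)%R).
      { rewrite Rmin_left, Rmax_right by lra; intros r Hr.
        rewrite Hm, RtoC_inv by lra; reflexivity. }
      apply (is_RInt_path_der (fun r : R => G (ln r))); auto; intros r Hr.
      * apply (is_der_comp RtoC (fun r : R => RtoC (ln r))); auto.
        apply path_der_ln; lra.
      * apply cont_mult.
        -- apply (cont_comp RtoC (fun r : R => RtoC (ln r))).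
           ++ exact (is_der_cont _ _ _ _ (HF _)).
           ++ apply (is_der_cont RtoC _ r (/ r)%R), path_der_ln; lra.
        -- apply (is_der_cont RtoC _ r (- / (r * r))%R), path_der_real.
           auto_derive; [lra | field; lra].
    + apply HP, C_NormedModule_mixin_compat1; rewrite ln_1.
      specialize (Hl (ln t) (in_strip_RtoC (ln t) (Rle_trans _ _ _ Hln Hs))).
      specialize (H (ln t) Hln); apply Rlt_div_r in H; [|lra].
      apply Rle_lt_trans with (K * exp (a * ln t))%R; [exact Hl|].
      generalize (exp_pos (a * ln t)); nra.
Qed.

(** * The kernel in the variable [u = ln t] *)

(** For [t = exp u], the integrand of [frakM] contains [exp (- z expo)] and [f (z dil)]. The power
    of [t] has become [exp (- nu u)], which has no branches. *)
Definition expo (x nu u : C) : C := Cexp (- nu * u) * (1 - (1 - x) * Cexp u) / x.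
Definition dil (x nu u : C) : C := Cexp (- nu * u) * (1 - Cexp u) / x.

Definition expo' (x nu u : C) : C :=
  - nu * expo x nu u - Cexp (- nu * u) * (1 - x) * Cexp u / x.
Definition dil' (x nu u : C) : C :=
  - nu * dil x nu u - Cexp (- nu * u) * Cexp u / x.

Definition kernel (x nu : C) (f : C -> C) (z u : C) : C :=
  Cexp (- (z * expo x nu u)) * f (z * dil x nu u).
(** The derivative of [kernel] in [z], with [f1] in the role of the derivative of [f]. *)
Definition kernel_z (x nu : C) (f f1 : C -> C) (z u : C) : C :=
  Cexp (- (z * expo x nu u)) *
    (dil x nu u * f1 (z * dil x nu u) - expo x nu u * f (z * dil x nu u)).

Lemma holo_cexp_lin (c z : C) : holo (fun u => Cexp (c * u)) z (c * Cexp (c * z)).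
Proof.
  apply is_der_eq with (Cexp (c * z) * c); [|ring].
  apply (is_der_Cexp (fun w : C => w) (fun u => c * u)), holo_scal.
Qed.

Lemma holo_expo (x nu u : C) : x <> 0 -> holo (expo x nu) u (expo' x nu u).
Proof.
  intros Hx; apply is_der_ext with
    (fun u => / x * (Cexp (- nu * u) * (1 - (1 - x) * Cexp u))).
  { intros w; unfold expo; field; auto. }
  apply is_der_eq with (/ x * (- nu * Cexp (- nu * u) * (1 - (1 - x) * Cexp u)
    + Cexp (- nu * u) * (0 - (1 - x) * Cexp u))).
  - apply is_der_scal.
    apply (is_der_mult (fun w : C => w) (fun u => Cexp (- nu * u))
      (fun u => 1 - (1 - x) * Cexp u)); [apply holo_cexp_lin|].
    apply is_der_minus; [apply is_der_const | apply is_der_scal, holo_Cexp].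
  - unfold expo', expo; field; auto.
Qed.

Lemma holo_dil (x nu u : C) : x <> 0 -> holo (dil x nu) u (dil' x nu u).
Proof.
  intros Hx; apply is_der_ext with
    (fun u => / x * (Cexp (- nu * u) * (1 - Cexp u))).
  { intros w; unfold dil; field; auto. }
  apply is_der_eq with (/ x * (- nu * Cexp (- nu * u) * (1 - Cexp u)
    + Cexp (- nu * u) * (0 - Cexp u))).
  - apply is_der_scal.
    apply (is_der_mult (fun w : C => w) (fun u => Cexp (- nu * u))
      (fun u => 1 - Cexp u)); [apply holo_cexp_lin|].
    apply is_der_minus; [apply is_der_const | apply holo_Cexp].
  - unfold dil', dil; field; auto.
Qed.

Lemma holo_kernel (x nu : C) (f f1 : C -> C) (z u : C) :
  x <> 0 -> (forall w, holo f w (f1 w)) ->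
  holo (kernel x nu f z) u (Cexp (- (z * expo x nu u)) *
    (z * dil' x nu u * f1 (z * dil x nu u)
     - z * expo' x nu u * f (z * dil x nu u))).
Proof.
  intros Hx Hf.
  apply is_der_eq with
    ((Cexp (- (z * expo x nu u)) * - (z * expo' x nu u)) * f (z * dil x nu u)
     + Cexp (- (z * expo x nu u)) * (f1 (z * dil x nu u) * (z * dil' x nu u)));
    [|ring].
  apply (is_der_mult (fun w : C => w) (fun u => Cexp (- (z * expo x nu u)))
    (fun u => f (z * dil x nu u))).
  - apply (is_der_Cexp (fun w : C => w) (fun u => - (z * expo x nu u))).
    now apply is_der_opp, is_der_scal, holo_expo.
  - apply (is_der_comp (fun w : C => w) (fun u => z * dil x nu u)); auto.
    now apply is_der_scal, holo_dil.
Qed.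

Lemma holo_kernel_z (x nu : C) (f f1 f2 : C -> C) (z : C) :
  x <> 0 -> (forall w, holo f w (f1 w)) -> (forall w, holo f1 w (f2 w)) ->
  exists k, forall u, holo (kernel_z x nu f f1 z) u (k u).
Proof.
  intros Hx Hf Hf1.
  eexists (fun u => (Cexp (- (z * expo x nu u)) * - (z * expo' x nu u))
      * (dil x nu u * f1 (z * dil x nu u) - expo x nu u * f (z * dil x nu u))
    + Cexp (- (z * expo x nu u)) *
      ((dil' x nu u * f1 (z * dil x nu u)
        + dil x nu u * (f2 (z * dil x nu u) * (z * dil' x nu u)))
       - (expo' x nu u * f (z * dil x nu u)
        + expo x nu u * (f1 (z * dil x nu u) * (z * dil' x nu u))))).
  intros u.
  assert (Hd : holo (fun u => z * dil x nu u) u (z * dil' x nu u))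
    by now apply is_der_scal, holo_dil.
  apply (is_der_mult (fun w : C => w) (fun u => Cexp (- (z * expo x nu u)))
    (fun u => dil x nu u * f1 (z * dil x nu u) - expo x nu u * f (z * dil x nu u))).
  - apply (is_der_Cexp (fun w : C => w) (fun u => - (z * expo x nu u))).
    now apply is_der_opp, is_der_scal, holo_expo.
  - apply is_der_minus.
    + apply (is_der_mult (fun w : C => w) (dil x nu) (fun u => f1 (z * dil x nu u)));
        [now apply holo_dil|].
      now apply (is_der_comp (fun w : C => w) (fun u => z * dil x nu u)).
    + apply (is_der_mult (fun w : C => w) (expo x nu) (fun u => f (z * dil x nu u)));
        [now apply holo_expo|].
      now apply (is_der_comp (fun w : C => w) (fun u => z * dil x nu u)).
Qed.

(** Here [al] and [be] are the values of [expo] and [dil] at a fixed [u]. Applied to [f1] as well,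
    it yields the second derivative of the kernel in [z]. *)
Lemma holo_in_z (f f1 : C -> C) (al be z : C) :
  (forall w, holo f w (f1 w)) ->
  holo (fun z => Cexp (- (z * al)) * f (z * be)) z
    (Cexp (- (z * al)) * (be * f1 (z * be) - al * f (z * be))).
Proof.
  intros Hf.
  assert (Hm : forall c : C, holo (fun z => z * c) z c).
  { intros c; apply is_der_ext with (fun z => c * z); [intros; ring|].
    apply holo_scal. }
  apply is_der_eq with ((Cexp (- (z * al)) * - al) * f (z * be)
    + Cexp (- (z * al)) * (f1 (z * be) * be)); [|ring].
  apply (is_der_mult (fun w : C => w) (fun z => Cexp (- (z * al)))
    (fun z => f (z * be))).
  - apply (is_der_Cexp (fun w : C => w) (fun z => - (z * al))), is_der_opp, Hm.
  - apply (is_der_comp (fun w : C => w) (fun z => z * be)); auto.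
Qed.

(** Off the real axis the modulus also involves [Im nu * Im u], which the strip keeps bounded. *)
Lemma Cexp_strip_bound (nu u : C) : in_strip u ->
  Cmod (Cexp (- nu * u)) <= exp (Rabs (Im nu) * PI) * exp (- Re nu * Re u).
Proof.
  intros [_ Hu]; rewrite Cmod_Cexp, <- exp_plus; apply exp_le_compat; simpl.
  assert (H : Im nu * Im u <= Rabs (Im nu) * PI).
  { eapply Rle_trans; [apply Rle_abs|]; rewrite Rabs_mult.
    apply Rmult_le_compat_l; auto; apply Rabs_pos. }
  unfold Im, Re in *; lra.
Qed.

Lemma Cmod_Cexp_strip (u : C) : in_strip u -> Cmod (Cexp u) <= 1.
Proof.
  intros [Hu _]; rewrite Cmod_Cexp, <- exp_0; now apply exp_le_compat.
Qed.

Lemma expo_dil_bound (x nu : C) : x <> 0 -> exists A, 0 < A /\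
  forall u, in_strip u -> Cmod (expo x nu u) <= A * exp (- Re nu * Re u) /\
    Cmod (dil x nu u) <= A * exp (- Re nu * Re u).
Proof.
  intros Hx; assert (Hx0 := proj1 (Cmod_gt_0 x) Hx).
  assert (H1x := Cmod_ge_0 (1 - x)).
  set (E := exp (Rabs (Im nu) * PI)).
  assert (HE : 0 < E) by apply exp_pos.
  exists (E * (2 + Cmod (1 - x)) / Cmod x)%R; split.
  { apply Rdiv_lt_0_compat; auto; apply Rmult_lt_0_compat; lra. }
  intros u Hu; assert (Hn := Cexp_strip_bound nu u Hu); fold E in Hn.
  assert (Hu1 := Cmod_Cexp_strip u Hu).
  assert (Hgen : forall c : C, Cmod c <= 2 + Cmod (1 - x) ->
    Cmod (Cexp (- nu * u) * c / x) <=
      E * (2 + Cmod (1 - x)) / Cmod x * exp (- Re nu * Re u)).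
  { intros c Hc; rewrite Cmod_div, Cmod_mult by auto.
    replace (E * (2 + Cmod (1 - x)) / Cmod x * exp (- Re nu * Re u))%R with
      ((E * exp (- Re nu * Re u)) * (2 + Cmod (1 - x)) / Cmod x)%R by (field; lra).
    apply Rmult_le_compat_r; [left; now apply Rinv_0_lt_compat|].
    apply Rmult_le_compat; auto; apply Cmod_ge_0. }
  split; apply Hgen; (eapply Rle_trans; [apply Cmod_triangle_sub|]);
    rewrite Cmod_1, ?Cmod_mult; generalize (Cmod_ge_0 (Cexp u)); nra.
Qed.

(** Each bound gets its decay from a factor [expo] or [dil]: in [kernel] it comes from [f 0 = 0] and
    the Lipschitz estimate for [f], in [kernel_z] it is explicit, and each term of the second
    derivative in [z] has two. The last bound is the Taylor remainder in [z], uniform in [u]. *)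
Lemma kernel_bounds (x nu : C) (f f1 f2 : C -> C) (z : C) :
  x <> 0 -> Re nu < 0 -> f 0 = 0 ->
  (forall w, holo f w (f1 w)) -> (forall w, holo f1 w (f2 w)) ->
  (forall w, ccont f2 w) ->
  exists K, 0 <= K /\ forall u, in_strip u ->
    Cmod (kernel x nu f z u) <= K * exp (- Re nu * Re u) /\
    Cmod (kernel_z x nu f f1 z u) <= K * exp (- Re nu * Re u) /\
    forall k, Cmod k <= 1 ->
      Cmod (kernel x nu f (z + k) u - kernel x nu f z u - k * kernel_z x nu f f1 z u)
      <= K * Cmod k * Cmod k * exp (- Re nu * Re u).
Proof.
  intros Hx Hnu Hf0 Hf Hf1 Hf2.
  destruct (expo_dil_bound x nu Hx) as [A [HA HAb]].
  set (rho := (Cmod z + 1)%R).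
  assert (Hz0 := Cmod_ge_0 z); assert (Hrho : 1 <= rho) by (unfold rho; lra).
  destruct (ccont_bounded f (rho * A)%R) as [B0 [HB0 Hb0]].
  { intros w; exact (is_der_cont _ _ _ _ (Hf w)). }
  destruct (ccont_bounded f1 (rho * A)%R) as [B1 [HB1 Hb1]].
  { intros w; exact (is_der_cont _ _ _ _ (Hf1 w)). }
  destruct (ccont_bounded f2 (rho * A)%R Hf2) as [B2 [HB2 Hb2]].
  set (E := exp (rho * A)); assert (HE : 0 < E) by apply exp_pos.
  set (B := (B0 + B1 + B2)%R).
  assert (HB : 0 < B) by (unfold B; lra).
  (* The summands [rho], [1] and [4 * A] serve the three bounds in this order; the last one needs
     only [2 * A]. *)
  exists (E * B * A * (1 + rho + 4 * A))%R; split.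
  { apply Rmult_le_pos; [|nra].
    apply Rmult_le_pos; [|lra]; apply Rmult_le_pos; lra. }
  intros u Hu; destruct (HAb u Hu) as [Ha Hd].
  unfold kernel, kernel_z.
  set (al := expo x nu u) in *; set (be := dil x nu u) in *.
  set (e := exp (- Re nu * Re u)) in *.
  assert (He0 : 0 < e) by apply exp_pos.
  assert (He1 : e <= 1).
  { unfold e; rewrite <- exp_0; apply exp_le_compat.
    destruct Hu as [Hu _]; nra. }
  assert (HaA : Cmod al <= A) by nra; assert (HdA : Cmod be <= A) by nra.
  assert (Hal := Cmod_ge_0 al); assert (Hbe := Cmod_ge_0 be).
  assert (Hin : forall y, Cmod y <= rho -> Cmod (y * be) <= rho * A).
  { intros y Hy; rewrite Cmod_mult; apply Rmult_le_compat; auto; apply Cmod_ge_0. }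
  assert (HEb : forall y, Cmod y <= rho -> Cmod (Cexp (- (y * al))) <= E).
  { intros y Hy; rewrite Cmod_Cexp; unfold E; apply exp_le_compat.
    eapply Rle_trans; [apply Rle_abs|].
    eapply Rle_trans; [apply re_le_Cmod|].
    rewrite Cmod_opp, Cmod_mult; apply Rmult_le_compat; auto; apply Cmod_ge_0. }
  assert (Hzr : Cmod z <= rho) by (unfold rho; lra).
  assert (HEB : 0 < E * B) by (now apply Rmult_lt_0_compat).
  assert (HEBA : 0 < E * B * A) by (now apply Rmult_lt_0_compat).
  assert (HEBAe : 0 < E * B * A * e) by (now apply Rmult_lt_0_compat).
  split; [|split].
  - assert (Hfz : Cmod (f (z * be)) <= B * (rho * (A * e))).
    { replace (f (z * be)) with (f (0 + z * be) - f 0)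
        by (rewrite Hf0, Cplus_0_l; ring).
      apply Rle_trans with (B * Cmod (z * be))%R.
      - apply holo_lipschitz with f1; auto; intros t Ht.
        apply Rle_trans with B1; [|unfold B; lra]; apply Hb1.
        rewrite Cplus_0_l, Cmod_mult, Cmod_R, Rabs_pos_eq by lra.
        generalize (Hin z Hzr) (Cmod_ge_0 (z * be)); nra.
      - rewrite Cmod_mult; apply Rmult_le_compat_l; [lra|].
        apply Rmult_le_compat; auto. }
    rewrite Cmod_mult.
    apply Rle_trans with (E * (B * (rho * (A * e))))%R.
    + apply Rmult_le_compat; auto; apply Cmod_ge_0.
    + replace (E * (B * (rho * (A * e))))%R with (E * B * A * e * rho)%R by ring.
      replace (E * B * A * (1 + rho + 4 * A) * e)%R with
        (E * B * A * e * (1 + rho + 4 * A))%R by ring.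
      apply Rmult_le_compat_l; lra.
  - assert (Hs : Cmod (be * f1 (z * be) - al * f (z * be)) <= A * e * B).
    { eapply Rle_trans; [apply Cmod_triangle_sub|]; rewrite !Cmod_mult.
      apply Rle_trans with (A * e * B1 + A * e * B0)%R.
      - apply Rplus_le_compat; apply Rmult_le_compat; auto; apply Cmod_ge_0.
      - unfold B; assert (0 < A * e) by (now apply Rmult_lt_0_compat); nra. }
    rewrite Cmod_mult; apply Rle_trans with (E * (A * e * B))%R.
    + apply Rmult_le_compat; auto; apply Cmod_ge_0.
    + replace (E * (A * e * B))%R with (E * B * A * e * 1)%R by ring.
      replace (E * B * A * (1 + rho + 4 * A) * e)%R with
        (E * B * A * e * (1 + rho + 4 * A))%R by ring.
      apply Rmult_le_compat_l; lra.
  - intros k Hk.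
    replace (E * B * A * (1 + rho + 4 * A) * Cmod k * Cmod k * e)%R with
      (E * B * A * (1 + rho + 4 * A) * e * Cmod k * Cmod k)%R by ring.
    apply (holo_taylor2 (fun z => Cexp (- (z * al)) * f (z * be))
      (fun z => Cexp (- (z * al)) * (be * f1 (z * be) - al * f (z * be)))
      (fun z => Cexp (- (z * al)) * (be * (be * f2 (z * be) - al * f1 (z * be))
        - al * (be * f1 (z * be) - al * f (z * be))))).
    + intros t _; now apply holo_in_z.
    + intros t _.
      apply (is_der_ext (fun w : C => w)
        (fun z => be * (Cexp (- (z * al)) * f1 (z * be))
          - al * (Cexp (- (z * al)) * f (z * be)))); [intros; ring|].
      eapply is_der_eq; [apply is_der_minus; apply is_der_scal|].
      * apply (holo_in_z f1 f2); auto.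
      * apply (holo_in_z f f1); auto.
      * ring.
    + intros t Ht; set (y := z + t * k).
      assert (Hy : Cmod y <= rho).
      { unfold y, rho; eapply Rle_trans; [apply Cmod_triangle|].
        rewrite Cmod_mult, Cmod_R, Rabs_pos_eq by lra.
        generalize (Cmod_ge_0 k); nra. }
      assert (H0 := Hb0 _ (Hin y Hy)); assert (H1 := Hb1 _ (Hin y Hy)).
      assert (H2 := Hb2 _ (Hin y Hy)).
      (* Of the two small factors, one is merely bounded by [A] and the other supplies the decay
         [e]. *)
      assert (Hpr : forall a b c : C, forall M,
        Cmod a <= A -> Cmod b <= A * e -> Cmod c <= M ->
        Cmod (a * (b * c)) <= A * (A * e * M)).
      { intros a b c M Hca Hcb Hcc; rewrite !Cmod_mult.
        apply Rmult_le_compat; auto; try apply Cmod_ge_0.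
        - apply Rmult_le_pos; apply Cmod_ge_0.
        - apply Rmult_le_compat; auto; apply Cmod_ge_0. }
      assert (Hs : Cmod (be * (be * f2 (y * be) - al * f1 (y * be))
        - al * (be * f1 (y * be) - al * f (y * be))) <= A * (A * e * B) * 2).
      { replace (be * (be * f2 (y * be) - al * f1 (y * be))
          - al * (be * f1 (y * be) - al * f (y * be))) with
          ((be * (be * f2 (y * be)) - be * (al * f1 (y * be)))
           - (al * (be * f1 (y * be)) - al * (al * f (y * be)))) by ring.
        eapply Rle_trans; [apply Cmod_triangle_sub|].
        eapply Rle_trans; [apply Rplus_le_compat; apply Cmod_triangle_sub|].
        generalize (Hpr be be _ _ HdA Hd H2) (Hpr be al _ _ HdA Ha H1)
          (Hpr al be _ _ HaA Hd H1) (Hpr al al _ _ HaA Ha H0).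
        assert (HAAe : 0 < A * (A * e)) by (repeat apply Rmult_lt_0_compat; auto).
        unfold B; nra. }
      rewrite Cmod_mult; apply Rle_trans with (E * (A * (A * e * B) * 2))%R.
      * apply Rmult_le_compat; auto; apply Cmod_ge_0.
      * replace (E * (A * (A * e * B) * 2))%R with (E * B * A * e * (2 * A))%R by ring.
        replace (E * B * A * (1 + rho + 4 * A) * e)%R with
          (E * B * A * e * (1 + rho + 4 * A))%R by ring.
        apply Rmult_le_compat_l; lra.
Qed.

(** * The operator [frakM] *)

Lemma nonpos_real_neq_0 (x : C) : ~ nonpos_real x -> x <> 0.
Proof. intros H ->; apply H; split; simpl; lra. Qed.

(** * Principal logarithm and powers *)

Lemma cos_sin_acos (y : R) : - PI < y < PI ->
  (if Rle_dec 0 (sin y) then acos (cos y) else (- acos (cos y))%R) = y.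
Proof.
  intros Hy; destruct (Rle_dec 0 (sin y)) as [Hs|Hs].
  - destruct (Rle_dec 0 y) as [H|H]; [apply acos_cos; lra|].
    assert (0 < sin (- y)) by (apply sin_gt_0; lra); rewrite sin_neg in *; lra.
  - destruct (Rle_dec 0 y) as [H|H].
    + assert (0 <= sin y) by (apply sin_ge_0; lra); lra.
    + rewrite <- (cos_neg y), acos_cos; lra.
Qed.

Lemma Clog_Cexp (v : C) : Rabs (Im v) < PI -> Clog (Cexp v) = v.
Proof.
  intros Hv; apply Rabs_def2 in Hv; unfold Clog, Carg.
  assert (He := exp_pos (Re v)).
  rewrite Cmod_Cexp, ln_exp.
  replace (Re (Cexp v) / exp (Re v))%R with (cos (Im v))
    by (unfold Cexp; simpl; field; lra).
  replace (Im (Cexp v)) with (exp (Re v) * sin (Im v))%R by reflexivity.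
  assert (E := cos_sin_acos (Im v) ltac:(lra)).
  destruct v as [a b]; simpl in *; f_equal.
  destruct (Rle_dec 0 (exp a * sin b)) as [H|H], (Rle_dec 0 (sin b)) as [H'|H'];
    auto; exfalso; [apply H' | apply H]; nra.
Qed.

Lemma Cpower_Cexp (v a : C) : Rabs (Im v) < PI -> Cpower (Cexp v) a = Cexp (a * v).
Proof.
  intros Hv; unfold Cpower; destruct (Ceq_dec (Cexp v) 0) as [E|_].
  - exfalso; now apply (Cexp_neq_0 v).
  - now rewrite Clog_Cexp.
Qed.

Lemma Cexp_ln (t : R) : 0 < t -> Cexp (ln t) = t.
Proof.
  intros Ht; unfold Cexp; simpl; rewrite exp_ln, cos_0, sin_0 by auto.
  apply injective_projections; simpl; ring.
Qed.

Lemma Cpower_pos (t : R) (a : C) : 0 < t -> Cpower t a = Cexp (a * ln t).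
Proof.
  intros Ht; rewrite <- (Cexp_ln t) at 1 by auto; apply Cpower_Cexp.
  simpl; rewrite Rabs_R0; apply PI_RGT_0.
Qed.

(** * Convergence and differentiation of the integral *)

Lemma frakM_integrand_kernel (x nu : C) (f : C -> C) (z : C) (t : R) :
  x <> 0 -> 0 < t -> frakM_integrand x nu f z t = kernel x nu f z (ln t) / t.
Proof.
  intros Hx Ht; unfold frakM_integrand, kernel, expo, dil.
  rewrite Cpower_pos, (Cexp_ln t) by auto.
  set (E := Cexp (- nu * ln t)).
  replace (z / x * E * (1 - (1 - x) * t)) with (z * (E * (1 - (1 - x) * t) / x))
    by (field; auto).
  now replace (z / x * E * (1 - t)) with (z * (E * (1 - t) / x)) by (field; auto).
Qed.

Lemma frakM_tail (x nu : C) (f : C -> C) (z : C) :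
  ~ nonpos_real x -> Re nu < 0 -> scrH0 f ->
  is_tail_int (- Re nu) (kernel x nu f z) (frakM x nu f z) /\
  is_RInt_gen (V := C_R_NormedModule) (frakM_integrand x nu f z)
    (at_right 0) (at_point 1) (frakM x nu f z).
Proof.
  intros Hx Hnu [Hf Hf0]; apply nonpos_real_neq_0 in Hx.
  assert (Ha : 0 < - Re nu) by lra.
  assert (Hf1 : forall w, holo f w (C_derive f w)) by (intros w; now apply ex_derive_holo).
  destruct (holo_derivative f _ Hf1) as [f2 Hf2].
  (* The existence of [f3] gives the continuity of [f2] that [kernel_bounds] requires. *)
  destruct (holo_derivative _ f2 Hf2) as [f3 Hf3].
  destruct (kernel_bounds x nu f (C_derive f) f2 z Hx Hnu Hf0 Hf1 Hf2) as [K [HK HKb]].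
  { intros w; exact (is_der_cont _ _ _ _ (Hf3 w)). }
  assert (Hk := fun u => holo_kernel x nu f _ z u Hx Hf1).
  destruct (ex_tail_int (- Re nu) K _ _ Ha HK Hk) as [l [Hl _]].
  { intros u Hu; apply HKb, Hu. }
  assert (HI : is_RInt_gen (V := C_R_NormedModule) (frakM_integrand x nu f z)
    (at_right 0) (at_point 1) l).
  { apply (is_tail_int_RInt_gen _ _ _ _ _ Ha Hk Hl).
    intros t Ht; now apply frakM_integrand_kernel. }
  assert (E : frakM x nu f z = l).
  { apply (is_RInt_gen_unique (V := C_R_CompleteNormedModule)); exact HI. }
  rewrite E; auto.
Qed.

(** By linearity the first-order remainder of [frakM x nu f] is itself the tail integral of the
    remainder of the kernel. The latter is entire in [u] and at most [K * Cmod h * Cmod h] times the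
    decaying factor, so [ex_tail_int] bounds its integral quadratically in [h]. *)
Lemma frakM_holo (x nu : C) (f : C -> C) (z : C) :
  ~ nonpos_real x -> Re nu < 0 -> scrH0 f ->
  exists D, is_tail_int (- Re nu) (kernel_z x nu f (C_derive f) z) D /\
    holo (frakM x nu f) z D.
Proof.
  intros Hx Hnu Hf.
  assert (HM := fun z => proj1 (frakM_tail x nu f z Hx Hnu Hf)).
  destruct Hf as [Hf Hf0]; apply nonpos_real_neq_0 in Hx.
  assert (Ha : 0 < - Re nu) by lra.
  assert (Hf1 : forall w, holo f w (C_derive f w)) by (intros w; now apply ex_derive_holo).
  destruct (holo_derivative f _ Hf1) as [f2 Hf2].
  destruct (holo_derivative _ f2 Hf2) as [f3 Hf3].
  destruct (kernel_bounds x nu f (C_derive f) f2 z Hx Hnu Hf0 Hf1 Hf2) as [K [HK HKb]].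
  { intros w; exact (is_der_cont _ _ _ _ (Hf3 w)). }
  destruct (holo_kernel_z x nu f _ f2 z Hx Hf1 Hf2) as [k' Hk'].
  destruct (ex_tail_int (- Re nu) K _ _ Ha HK Hk') as [D [HD _]].
  { intros u Hu; apply HKb, Hu. }
  exists D; split; auto.
  set (c := (/ - Re nu + PI)%R).
  assert (Hc : 0 < c).
  { assert (0 < / - Re nu) by (apply Rinv_0_lt_compat; lra).
    generalize PI_RGT_0; unfold c; lra. }
  (* The [1] is the range of increments allowed in [kernel_bounds]; the quotient makes
     [K * c * Cmod h] at most [e]. *)
  intros e He; exists (Rmin 1 (e / (K * c + 1)))%R.
  assert (HKc : 0 <= K * c) by (apply Rmult_le_pos; lra).
  split; [apply Rmin_pos; [lra | apply Rdiv_lt_0_compat; lra]|].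
  intros w Hw.
  assert (H1 := Rlt_le_trans _ _ _ Hw (Rmin_l _ _)).
  assert (H2 := Rlt_le_trans _ _ _ Hw (Rmin_r _ _)).
  apply Rlt_div_r in H2; [|lra].
  set (h := w - z) in *.
  assert (HR : is_tail_int (- Re nu) (fun u => kernel x nu f w u - kernel x nu f z u
    - h * kernel_z x nu f (C_derive f) z u)
    (frakM x nu f w - frakM x nu f z - h * D)).
  { apply is_tail_int_minus; [now apply is_tail_int_minus | now apply is_tail_int_scal]. }
  destruct (ex_tail_int (- Re nu) (K * Cmod h * Cmod h)
    (fun u => kernel x nu f w u - kernel x nu f z u
      - h * kernel_z x nu f (C_derive f) z u)
    (fun u => _) Ha
    ltac:(apply Rmult_le_pos; [apply Rmult_le_pos; [lra|]|]; apply Cmod_ge_0)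
    (fun u => is_der_minus _ _ _ u _ _
      (is_der_minus _ _ _ u _ _ (holo_kernel x nu f _ w u Hx Hf1)
        (holo_kernel x nu f _ z u Hx Hf1))
      (is_der_scal _ _ h u _ (Hk' u)))) as [l [Hl Hlb]].
  { intros u Hu; replace w with (z + h) by (unfold h; ring).
    apply HKb; auto; lra. }
  rewrite (is_tail_int_unique _ _ _ _ Ha HR Hl).
  eapply Rle_trans; [exact Hlb|]; fold c.
  generalize (Cmod_ge_0 h); nra.
Qed.

(** At [z = 0] the kernel vanishes identically, so [ex_tail_int] applies with the bound [0]. *)
Lemma frakM_0 (x nu : C) (f : C -> C) :
  ~ nonpos_real x -> Re nu < 0 -> scrH0 f -> frakM x nu f 0 = 0.
Proof.
  intros Hx Hnu Hf; assert (H := proj1 (frakM_tail x nu f 0 Hx Hnu Hf)).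
  destruct Hf as [Hf Hf0]; apply nonpos_real_neq_0 in Hx.
  assert (Ha : 0 < - Re nu) by lra.
  assert (Hf1 : forall w, holo f w (C_derive f w)) by (intros w; now apply ex_derive_holo).
  destruct (ex_tail_int (- Re nu) 0 _ _ Ha (Rle_refl 0)
    (fun u => holo_kernel x nu f _ 0 u Hx Hf1)) as [l [Hl Hlb]].
  { intros u _; unfold kernel; rewrite (Cmult_0_l (dil x nu u)), Hf0, Cmult_0_r, Cmod_0.
    lra. }
  rewrite (is_tail_int_unique _ _ _ _ Ha H Hl).
  apply Cmod_eq_0, Rle_antisym; [lra | apply Cmod_ge_0].
Qed.

(** * The operator [frakL] *)

(** The segment from [1] to [x], which is the base of the second power in [frakR]. *)
Definition seg (x : C) (t : R) : C := 1 - (1 - x) * t.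

(** The slit plane is star-shaped about [1]. *)
Lemma seg_not_nonpos (x : C) (t : R) :
  ~ nonpos_real x -> 0 <= t <= 1 -> ~ nonpos_real (seg x t).
Proof.
  intros Hx Ht [H1 H2]; apply Hx; destruct x as [a b]; unfold seg, nonpos_real in *.
  simpl in *.
  assert (Hb : (t * b)%R = 0%R) by lra.
  apply Rmult_integral in Hb; destruct Hb as [->| ->]; [lra|].
  split; auto; nra.
Qed.

(** Freezing the parameter outside [[0, 1]] makes the logarithmic derivative of [seg x] continuous
    on the whole line, as [path_primitive] requires. *)
Definition clamp (t : R) : R := Rmax 0 (Rmin 1 t).

Lemma clamp_range (t : R) : 0 <= clamp t <= 1.
Proof.
  unfold clamp; split; [apply Rmax_l|].
  apply Rmax_lub; [lra | apply Rmin_l].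
Qed.

Lemma clamp_id (t : R) : 0 <= t <= 1 -> clamp t = t.
Proof. intros Ht; unfold clamp; rewrite Rmin_right, Rmax_right; lra. Qed.

Lemma clamp_cont (t : R) : cont RtoC (fun s => RtoC (clamp s)) t.
Proof.
  intros e He; exists e; split; auto; intros s; rewrite !RtoC_sub_mod; intros Hs.
  apply Rabs_def2 in Hs; apply Rabs_def1; unfold clamp, Rmax, Rmin;
    repeat destruct Rle_dec; lra.
Qed.

Lemma path_der_seg (x : C) (t : R) : path_der (seg x) t (- (1 - x)).
Proof.
  apply is_der_eq with (0 - (1 - x) * 1); [|ring].
  apply is_der_minus; [apply is_der_const | apply is_der_scal, is_der_incl].
Qed.

(** The continuous logarithm [lam] starting at [0] stays in the strip
    [|Im| < PI], where it is the principal one, because [seg x] does not meet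
    the cut. *)
Lemma seg_log (x : C) : ~ nonpos_real x ->
  exists lam lam' : R -> C, lam 0%R = 0 /\ (forall t, path_der lam t (lam' t)) /\
    forall t, 0 <= t <= 1 -> lam' t = - (1 - x) / seg x t /\
      Cexp (lam t) = seg x t /\ Rabs (Im (lam t)) < PI.
Proof.
  intros Hx.
  assert (Hnz : forall t, 0 <= t <= 1 -> seg x t <> 0).
  { intros t Ht; apply nonpos_real_neq_0, seg_not_nonpos; auto. }
  set (lam' := fun t => - (1 - x) * / seg x (clamp t)).
  destruct (path_primitive lam') as [L HL].
  { intros t; apply cont_scal, cont_inv; [apply Hnz, clamp_range|].
    apply cont_minus; [apply cont_const | apply cont_scal, clamp_cont]. }
  exists (fun t => L t - L 0%R), lam'.
  assert (HD : forall t, path_der (fun t => L t - L 0%R) t (lam' t)).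
  { intros t; apply is_der_eq with (lam' t - 0); [|ring].
    apply is_der_minus; auto; apply is_der_const. }
  assert (Hl' : forall t, 0 <= t <= 1 -> lam' t = - (1 - x) / seg x t).
  { intros t Ht; unfold lam'; now rewrite clamp_id. }
  assert (HE : forall t, 0 <= t <= 1 -> Cexp (L t - L 0%R) = seg x t).
  { intros t Ht.
    (* The quotient of [seg x] by the exponential of its logarithm has derivative zero. *)
    assert (Hc : Cexp (- (L t - L 0%R)) * seg x t
      = Cexp (- (L 0%R - L 0%R)) * seg x 0).
    { apply (path_der_zero_const (fun t => Cexp (- (L t - L 0%R)) * seg x t) 0 t);
        [lra|]; intros s Hs.
      apply is_der_eq with ((Cexp (- (L s - L 0%R)) * - lam' s) * seg x s
        + Cexp (- (L s - L 0%R)) * - (1 - x)).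
      - apply (is_der_mult RtoC (fun t => Cexp (- (L t - L 0%R))) (seg x));
          [|apply path_der_seg].
        apply (is_der_Cexp RtoC (fun t => - (L t - L 0%R))), is_der_opp, HD.
      - rewrite Hl' by lra; field; apply Hnz; lra. }
    rewrite Cexp_opp in Hc.
    replace (- (L 0%R - L 0%R)) with (RtoC 0) in Hc by ring.
    rewrite Cexp_0 in Hc.
    replace (seg x 0) with (RtoC 1) in Hc by (unfold seg; ring).
    assert (Hn := Cexp_neq_0 (L t - L 0%R)).
    transitivity (Cexp (L t - L 0%R) * (1 * 1)); [ring|].
    rewrite <- Hc; field; auto. }
  split; [ring|split; auto]; intros t Ht; repeat split; auto.
  apply Rnot_le_lt; intros Hbig.
  (* The imaginary part starts at [0]; to leave the strip it must take a value of modulus [PI], and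
     there the exponential, a point of the segment, is a negative real number. *)
  assert (Hpi : exists s, 0 <= s <= 1 /\ Rabs (Im (L s - L 0%R)) = PI).
  { assert (Hcont : continuity (fun s => Rabs (Im (L s - L 0%R)) - PI)%R).
    { intros s; apply continuity_pt_minus; [|apply continuity_pt_const; intros ? ?; auto].
      apply (continuity_pt_comp (fun s => Im (L s - L 0%R)) Rabs);
        [|apply Rcontinuity_abs].
      apply derivable_continuous_pt.
      exists (Re (- Ci * lam' s)); apply is_derive_Reals.
      apply is_derive_ext with (fun s => Re (- Ci * (L s - L 0%R))).
      { intros r; simpl; ring. }
      apply (path_der_Re (fun s => - Ci * (L s - L 0%R))), is_der_scal, HD. }
    destruct (IVT_cor (fun s => Rabs (Im (L s - L 0%R)) - PI)%R 0 t Hcont)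
      as [s [Hs Hs2]]; [lra| |].
    - replace (L 0%R - L 0%R) with (RtoC 0) by ring.
      rewrite im_RtoC, Rabs_R0; generalize PI_RGT_0; nra.
    - exists s; split; lra. }
  destruct Hpi as [s [Hs Hpi]].
  apply (seg_not_nonpos x s Hx Hs); rewrite <- HE by auto.
  destruct (L s - L 0%R) as [p q]; simpl in Hpi.
  assert (He := exp_pos p); unfold nonpos_real, Cexp; simpl.
  unfold Rabs in Hpi; destruct (Rcase_abs _).
  - replace q with (- PI)%R by lra.
    rewrite sin_neg, cos_neg, sin_PI, cos_PI; split; nra.
  - rewrite Hpi, sin_PI, cos_PI; split; nra.
Qed.

Lemma arc_der (lam lam' : R -> C) (t : R) : t < 1 -> path_der lam t (lam' t) ->
  path_der (fun s => RtoC (ln (1 - s)) - lam s) t (- / (1 - t) - lam' t).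
Proof.
  intros Ht Hl; apply is_der_minus; auto.
  replace (- / (1 - t)) with (RtoC (- / (1 - t))%R)
    by (rewrite RtoC_opp, RtoC_inv, RtoC_minus by lra; reflexivity).
  apply path_der_real; auto_derive; [lra | field; lra].
Qed.

Lemma arc_tends (lam : R -> C) (M : R) : cont RtoC lam 1%R ->
  exists d, 0 < d <= 1 /\ forall t, 1 - d < t < 1 ->
    Re (RtoC (ln (1 - t)) - lam t) <= M.
Proof.
  intros Hc; destruct (Hc 1%R Rlt_0_1) as [d [Hd D]].
  (* Near [1] the values of [lam] stay within distance [1] of [lam 1], whence the margin
     [Cmod (lam 1) + 1]. *)
  set (b := exp (M - Cmod (lam 1%R) - 1)); assert (Hb : 0 < b) by apply exp_pos.
  exists (Rmin 1 (Rmin d b)); split.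
  { split; [repeat apply Rmin_pos; lra | apply Rmin_l]. }
  intros t Ht.
  generalize (Rmin_l 1 (Rmin d b)) (Rmin_r 1 (Rmin d b)) (Rmin_l d b) (Rmin_r d b).
  intros H1 H2 H3 H4.
  assert (Hln : ln (1 - t) <= M - Cmod (lam 1%R) - 1).
  { rewrite <- (ln_exp (M - Cmod (lam 1%R) - 1)); fold b.
    left; apply ln_increasing; lra. }
  specialize (D t); rewrite RtoC_sub_mod, Rabs_left in D by lra.
  specialize (D ltac:(lra)).
  assert (Hl := Cmod_le_plus_sub (lam t) (lam 1%R)).
  assert (Hr := re_le_Cmod (lam t)).
  assert (Hr2 := Rle_abs (- Re (lam t))); rewrite Rabs_Ropp in Hr2.
  replace (Re (RtoC (ln (1 - t)) - lam t)) with (ln (1 - t) - Re (lam t))%R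
    by (destruct (lam t); reflexivity).
  lra.
Qed.

(** Since [v] lies in the open strip, it is the principal logarithm of [seg x t]. With
    [exp u = (1 - t) / seg x t] one gets [1 - (1 - x) exp u = x / seg x t] and
    [1 - exp u = x t / seg x t]; the remaining factor [seg x t] compensates the exponent [nu - 1] in
    [frakR]. *)
Lemma frakR_arc (x nu v : C) (t : R) :
  x <> 0 -> t < 1 -> Cexp v = seg x t -> Rabs (Im v) < PI ->
  let u := RtoC (ln (1 - t)) - v in
  Cexp u = (1 - t) / seg x t /\
  Cexp (- nu * u) = frakR x nu t * seg x t /\
  expo x nu u = frakR x nu t /\ dil x nu u = t * frakR x nu t.
Proof.
  intros Hx Ht Hv Hi u.
  assert (Hs : seg x t <> 0) by (rewrite <- Hv; apply Cexp_neq_0).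
  assert (Eu : Cexp u = (1 - t) / seg x t).
  { unfold u, Cminus at 1; rewrite Cexp_plus, Cexp_opp, Hv, Cexp_ln by lra.
    rewrite RtoC_minus; reflexivity. }
  assert (En : Cexp (- nu * u) = frakR x nu t * seg x t).
  { unfold frakR; fold (seg x t).
    replace (1 - t) with (RtoC (1 - t)%R) by apply RtoC_minus.
    rewrite Cpower_pos, <- Hv, Cpower_Cexp by (auto; lra).
    rewrite <- !Cexp_plus; f_equal; unfold u; ring. }
  repeat split; auto; unfold expo, dil; rewrite En, Eu; unfold seg in *; field; auto.
Qed.

(** The value [D] is the derivative of [frakM x nu f] at [z] found in [frakM_holo]; keeping it
    abstract separates the change of path from differentiation under the integral. *)
Lemma frakL_tail (x nu : C) (f : C -> C) (z D : C) :
  ~ nonpos_real x -> x <> 1 -> Re nu < 0 -> scrH0 f ->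
  is_tail_int (- Re nu) (kernel_z x nu f (C_derive f) z) D ->
  is_RInt (V := C_R_CompleteNormedModule) (frakL_integrand x nu f z) 0 1
    (x * nu * (1 - nu) / (1 - x) * (z * D)).
Proof.
  intros Hx Hx1 Hnu [Hf Hf0] [Phi [K [HPhi [HK HD]]]].
  destruct (seg_log x Hx) as [lam [lam' [Hl0 [Hl' Hlam]]]].
  apply nonpos_real_neq_0 in Hx.
  assert (H1x : 1 - x <> 0) by (apply Cminus_eq_contra; auto).
  assert (Ha : 0 < - Re nu) by lra.
  set (f1 := C_derive f) in *.
  assert (Hf1 : forall w, holo f w (f1 w)) by (intros w; now apply ex_derive_holo).
  destruct (holo_derivative f f1 Hf1) as [f2 Hf2].
  destruct (holo_derivative f1 f2 Hf2) as [f3 Hf3].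
  destruct (kernel_bounds x nu f f1 f2 z Hx Hnu Hf0 Hf1 Hf2) as [K1 [HK1 HKb]].
  { intros w; exact (is_der_cont _ _ _ _ (Hf3 w)). }
  destruct (expo_dil_bound x nu Hx) as [A [HA HAb]].
  set (u := fun t : R => RtoC (ln (1 - t)) - lam t).
  assert (Hu' : forall t, t < 1 -> path_der u t (- / (1 - t) - lam' t))
    by (intros t Ht; now apply arc_der).
  assert (Hlc : cont RtoC lam 1%R) by exact (is_der_cont _ _ _ _ (Hl' 1%R)).
  assert (Hstrip : forall e, 0 < e -> exists d, 0 < d <= 1 /\
    forall t, 1 - d < t < 1 -> in_strip (u t) /\ exp (- Re nu * Re (u t)) < e).
  { intros e He; destruct (exp_tail_small _ e Ha He) as [s [Hs H]].
    destruct (arc_tends lam s Hlc) as [d [Hd HM]]; exists d; split; auto.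
    intros t Ht; specialize (HM t Ht); fold (u t) in HM.
    split; [split|apply H; exact HM]; [lra|].
    destruct (Hlam t ltac:(lra)) as [_ [_ Hi]].
    replace (Im (u t)) with (- Im (lam t))%R
      by (unfold u; destruct (lam t); simpl; ring).
    rewrite Rabs_Ropp; lra. }
  (* A continuous function on the whole line that agrees with [frakR x nu] on [[0, 1[]; the value
     [0] from [1] on is the limit of [expo] along the arc. *)
  set (r := fun t => if Rlt_dec t 1 then expo x nu (u t) else 0).
  assert (Hr : forall t, 0 <= t < 1 -> r t = frakR x nu t).
  { intros t Ht; unfold r; destruct (Rlt_dec t 1); [|lra].
    destruct (Hlam t ltac:(lra)) as [_ [Hv Hi]].
    now apply (frakR_arc x nu (lam t) t). }
  assert (Hrc : forall t, cont RtoC r t).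
  { intros t e He; destruct (Rtotal_order t 1) as [Ht|[->|Ht]].
    - destruct (cont_comp RtoC u (expo x nu) t) with (eps := e) as [d [Hd Dd]]; auto.
      + exact (is_der_cont _ _ _ _ (holo_expo x nu (u t) Hx)).
      + exact (is_der_cont _ _ _ _ (Hu' t Ht)).
      + exists (Rmin d (1 - t)); split; [apply Rmin_pos; lra|]; intros w Hw.
        assert (Hw1 := Rlt_le_trans _ _ _ Hw (Rmin_r _ _)).
        rewrite RtoC_sub_mod in Hw1; apply Rabs_def2 in Hw1.
        unfold r; destruct (Rlt_dec w 1), (Rlt_dec t 1); try lra.
        apply Dd, (Rlt_le_trans _ _ _ Hw (Rmin_l _ _)).
    - destruct (Hstrip (e / A)%R) as [d [Hd Dd]]; [now apply Rdiv_lt_0_compat|].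
      exists d; split; [lra|]; intros w Hw.
      rewrite RtoC_sub_mod in Hw; apply Rabs_def2 in Hw.
      unfold r; destruct (Rlt_dec 1 1); [lra|]; destruct (Rlt_dec w 1) as [H|H].
      + destruct (Dd w ltac:(lra)) as [H1 H2]; apply Rlt_div_r in H2; auto.
        replace (expo x nu (u w) - 0) with (expo x nu (u w)) by ring.
        destruct (HAb _ H1) as [H3 _]; lra.
      + replace (0 - 0) with (RtoC 0) by ring; rewrite Cmod_0; auto.
    - exists (t - 1)%R; split; [lra|]; intros w Hw.
      rewrite RtoC_sub_mod in Hw; apply Rabs_def2 in Hw.
      unfold r; destruct (Rlt_dec w 1), (Rlt_dec t 1); try lra.
      replace (0 - 0) with (RtoC 0) by ring; rewrite Cmod_0; auto. }
  set (c := (1 - nu * x) / (1 - x)).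
  set (K0 := x * nu * (1 - nu) / (1 - x)).
  set (g := fun t : R => ((1 + z * r t) * f (t * r t * z)
    - c * z * r t * f1 (t * r t * z)) * Cexp (- r t * z)).
  assert (Hgc : forall t, cont RtoC g t).
  { intros t.
    assert (Hw : cont RtoC (fun t : R => t * r t * z) t).
    { apply cont_mult; [|apply cont_const].
      apply cont_mult; [apply cont_incl | auto]. }
    apply cont_mult.
    - apply cont_minus.
      + apply cont_mult.
        * apply cont_plus; [apply cont_const | apply cont_scal; auto].
        * apply (cont_comp RtoC (fun t : R => t * r t * z)); auto.
          exact (is_der_cont _ _ _ _ (Hf1 _)).
      + apply cont_mult; [apply cont_scal; auto|].
        apply (cont_comp RtoC (fun t : R => t * r t * z)); auto.
        exact (is_der_cont _ _ _ _ (Hf2 _)).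
    - apply (cont_Cexp RtoC (fun t => - r t * z)).
      apply cont_mult; [now apply cont_opp | apply cont_const]. }
  destruct (path_primitive g Hgc) as [Gam HGam].
  apply is_RInt_ext with g.
  { rewrite Rmin_left, Rmax_right by lra; intros t Ht.
    unfold g, frakL_integrand; rewrite Hr by lra; reflexivity. }
  replace (K0 * (z * D)) with (Gam 1%R - Gam 0%R).
  { apply is_RInt_path_der; auto; lra. }
  (* [(t - c) P - K0 z Phi] is a primitive of the integrand, for
     [P = kernel x nu f z (u t)]. *)
  set (S := fun t : R => (t - c) * kernel x nu f z (u t) - K0 * z * Phi (u t)).
  assert (HS : forall t, 0 <= t < 1 -> path_der S t (g t)).
  { intros t Ht; destruct (Hlam t ltac:(lra)) as [Hlt [Hv Hi]].
    destruct (frakR_arc x nu (lam t) t Hx (proj2 Ht) Hv Hi) as [E1 [E2 [E3 E4]]].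
    fold (u t) in E1, E2, E3, E4.
    assert (Hsz : seg x t <> 0) by (rewrite <- Hv; apply Cexp_neq_0).
    assert (H1t : 1 - t <> 0).
    { rewrite <- RtoC_minus; intro E; injection E; lra. }
    eapply is_der_eq.
    - apply is_der_minus.
      + apply (is_der_mult RtoC (fun t : R => t - c) (fun t => kernel x nu f z (u t))).
        * apply is_der_minus; [apply is_der_incl | apply is_der_const].
        * apply is_der_comp; [now apply holo_kernel | now apply Hu'].
      + apply is_der_scal, is_der_comp; [apply HPhi | now apply Hu'].
    - unfold g, kernel, kernel_z, expo', dil'; rewrite Hr, Hlt by auto.
      rewrite E3, E4, E2, E1.
      replace (- (frakR x nu t) * z) with (- (z * frakR x nu t)) by ring.
      replace (t * frakR x nu t * z) with (z * (t * frakR x nu t)) by ring.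
      (* With these values abstracted, a rational identity remains, which comes down to
         [((t - c) R)' = K0 R u']. *)
      generalize (f (z * (t * frakR x nu t))) (f1 (z * (t * frakR x nu t)))
        (Cexp (- (z * frakR x nu t))) (frakR x nu t).
      intros F F1 X Rr; unfold K0, c; unfold seg in *; field; auto. }
  assert (Hu0 : u 0%R = 0).
  { unfold u; rewrite Hl0, Rminus_0_r, ln_1; ring. }
  assert (HS0 : S 0%R = - (K0 * z * Phi 0)).
  { unfold S; rewrite Hu0; unfold kernel, dil; rewrite Cexp_0.
    replace (z * (_ * (1 - 1) / x)) with (RtoC 0) by (field; auto).
    rewrite Hf0; ring. }
  assert (HG0 : forall b, 0 <= b < 1 -> Gam b - Gam 0%R = S b - S 0%R).
  { intros b Hb.
    assert (H : Gam b - S b = Gam 0%R - S 0%R).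
    { apply (path_der_zero_const (fun t => Gam t - S t) 0 b); [lra|].
      intros t Ht; apply is_der_eq with (g t - g t); [|ring].
      apply is_der_minus; auto; apply HS; lra. }
    replace (Gam b - Gam 0%R) with ((Gam b - S b) + (S b - Gam 0%R)) by ring.
    rewrite H; ring. }
  (* The primitive [S] cannot be evaluated at [1], where [u] involves [ln 0]. The two primitives are
     compared at some [b < 1] close to [1], where [Gam] is continuous and the tail estimates are
     small. *)
  apply Ceq_minus, Cmod_eq_0, Rle_antisym; [|apply Cmod_ge_0].
  apply le_epsilon; intros e He; rewrite Rplus_0_l.
  (* The first summand comes from the tail estimate for [Phi], the second from the boundary term,
     where [Cmod (b - c) <= 1 + Cmod c]. *)
  set (B := (Cmod (K0 * z) * K + (1 + Cmod c) * K1)%R).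
  assert (HB : 0 <= B).
  { unfold B; generalize (Cmod_ge_0 (K0 * z)) (Cmod_ge_0 c); intros.
    apply Rplus_le_le_0_compat; apply Rmult_le_pos; lra. }
  destruct (is_der_cont _ _ _ _ (HGam 1%R) (e / 2)%R) as [d [Hd Dd]]; [lra|].
  destruct (Hstrip (e / 2 / (B + 1))%R) as [d' [Hd' Dd']].
  { apply Rdiv_lt_0_compat; lra. }
  set (b := (1 - Rmin d d' / 2)%R).
  assert (Hm : 0 < Rmin d d') by (apply Rmin_pos; lra).
  generalize (Rmin_l d d') (Rmin_r d d'); intros Hm1 Hm2.
  destruct (Dd' b) as [Hb1 Hb2]; [unfold b; lra|].
  apply Rlt_div_r in Hb2; [|lra].
  specialize (Dd b); rewrite RtoC_sub_mod in Dd.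
  specialize (Dd ltac:(unfold b; apply Rabs_def1; lra)).
  specialize (HG0 b ltac:(unfold b; lra)); rewrite HS0 in HG0.
  specialize (HD _ Hb1); destruct (HKb _ Hb1) as [HP _].
  replace (Gam 1%R - Gam 0%R - K0 * (z * D)) with
    ((Gam b - Gam 0%R) - K0 * (z * D) - (Gam b - Gam 1%R)) by ring.
  rewrite HG0; unfold S.
  replace ((b - c) * kernel x nu f z (u b) - K0 * z * Phi (u b)
    - - (K0 * z * Phi 0) - K0 * (z * D)) with
    (K0 * z * (Phi 0 - Phi (u b) - D) + (b - c) * kernel x nu f z (u b)) by ring.
  eapply Rle_trans; [apply Cmod_triangle_sub|].
  assert (Hbc : Cmod (b - c) <= 1 + Cmod c).
  { eapply Rle_trans; [apply Cmod_triangle_sub|]; rewrite Cmod_R, Rabs_pos_eq;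
      unfold b; lra. }
  assert (HX : Cmod (K0 * z * (Phi 0 - Phi (u b) - D) + (b - c) * kernel x nu f z (u b))
    <= B * exp (- Re nu * Re (u b))).
  { eapply Rle_trans; [apply Cmod_triangle|].
    rewrite (Cmod_mult (K0 * z)), (Cmod_mult (b - c)); unfold B.
    rewrite Rmult_plus_distr_r, !Rmult_assoc; apply Rplus_le_compat;
      apply Rmult_le_compat; auto; try apply Cmod_ge_0; lra. }
  generalize (exp_pos (- Re nu * Re (u b))); nra.
Qed.

Theorem proposition4p2 (x nu : C)
    (hx : ~ nonpos_real x) (hx1 : x <> 1) (hnu : (Re nu < 0)%R) :
  (* the integrals converge, and both operators map [scrH0] to [scrH0] *)
  (forall f : C -> C, scrH0 f ->
     (forall z : C, ex_RInt (V := C_R_NormedModule)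
                      (frakL_integrand x nu f z) 0%R 1%R) /\
     scrH0 (frakL x nu f)) /\
  (forall f : C -> C, scrH0 f ->
     (forall z : C, ex_RInt_gen (V := C_R_NormedModule)
                      (frakM_integrand x nu f z) (at_right 0%R) (at_point 1%R)) /\
     scrH0 (frakM x nu f)) /\
  (* the factorization *)
  (forall f : C -> C, scrH0 f -> forall z : C,
     frakL x nu f z = x * nu * (1 - nu) / (1 - x) * delta (frakM x nu f) z).
Proof.
  assert (HM : forall f, scrH0 f -> forall z,
    holo (frakM x nu f) z (C_derive (frakM x nu f) z)).
  { intros f Hf z; destruct (frakM_holo x nu f z hx hnu Hf) as [D [_ HD]].
    now rewrite (holo_C_derive _ _ _ HD). }
  assert (HL : forall f, scrH0 f -> forall z,
    is_RInt (V := C_R_CompleteNormedModule) (frakL_integrand x nu f z) 0%R 1%R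
      (x * nu * (1 - nu) / (1 - x) * delta (frakM x nu f) z)).
  { intros f Hf z; destruct (frakM_holo x nu f z hx hnu Hf) as [D [HD HD']].
    unfold delta; rewrite (holo_C_derive _ _ _ HD').
    now apply frakL_tail. }
  assert (HLv : forall f, scrH0 f -> forall z,
    frakL x nu f z = x * nu * (1 - nu) / (1 - x) * delta (frakM x nu f) z).
  { intros f Hf z; apply (is_RInt_unique (V := C_R_CompleteNormedModule)).
    now apply HL. }
  repeat split.
  - intros z; eexists; exact (HL f H z).
  (* That [frakL x nu f] is entire is read off the factorization, as [delta] preserves entire
     functions. *)
  - intros z; destruct (holo_derivative _ _ (HM f H)) as [M2 HM2].
    eexists; apply holo_is_derive.
    apply is_der_ext with (fun z => x * nu * (1 - nu) / (1 - x)
      * (z * C_derive (frakM x nu f) z)).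
    { intros w; symmetry; now apply HLv. }
    apply is_der_scal, (is_der_mult (fun w : C => w) (fun w => w));
      [apply is_der_incl | apply HM2].
  - rewrite HLv by auto; unfold delta; ring.
  - intros z; eexists; exact (proj2 (frakM_tail x nu f z hx hnu H)).
  - intros z; eexists; apply holo_is_derive, HM, H.
  - now apply frakM_0.
  - exact HLv.
Qed.
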